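(* Let $\tilde f=\tilde f(t,\tilde x,\tilde v)$ be the solution of $$\partial_t\tilde f+\mathcal{V}[\tilde f(t)](\tilde x,\tilde v)\cdot\nabla_{\tilde x}\tilde f+\mathcal{A}[\tilde f(t)](\tilde x,\tilde v)\cdot\nabla_{\tilde v}\tilde f=0,\quad(t,\tilde x,\tilde v)\in\mathbb{R}_+\times\mathbb{R}^2\times\mathbb{R}^2,$$ $$\tilde f(0,\tilde x,\tilde v)=f^{\mathrm{in}}\left(\tilde x-\omega_c^{-1}\,{}^\bot\tilde v,\tilde v\right),\quad(\tilde x,\tilde v)\in\mathbb{R}^2\times\mathbb{R}^2,$$ where $f^{\mathrm{in}}$ is a non negative, smooth, compactly supported function on $\mathbb{R}^2\times\mathbb{R}^2$. Then for any $t\in\mathbb{R}_+$, $$\frac{\mathrm{d}}{\mathrm{d}t}\,\frac12\int_{\mathbb{R}^2}\int_{\mathbb{R}^2}\tilde\phi[\tilde f(t)](\tilde x,\tilde v)\,\tilde f(t,\tilde x,\tilde v)\,\mathrm{d}\tilde v\,\mathrm{d}\tilde x=0.$$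
   Context: $\omega_c$ is a nonzero real constant. For $v=(v_1,v_2)\in\mathbb{R}^2$, ${}^\bot v=(v_2,-v_1)$; correspondingly ${}^\bot\nabla_z g=(\partial_{z_2}g,-\partial_{z_1}g)$ for a function $g$ of $z\in\mathbb{R}^2$ (possibly depending on further variables). $e(z)=-\frac{1}{2\pi}\ln|z|$ for $z\in\mathbb{R}^2\setminus\{0\}$. $\mathbf{1}_{\{\cdot\}}$ is the indicator function. The vector fields are $$\mathcal{V}[\tilde f(t)](\tilde x,\tilde v)=-\frac{1}{\omega_c}\,{}^\bot\nabla_{\tilde x}\tilde\phi[\tilde f(t)](\tilde x,\tilde v),\qquad\mathcal{A}[\tilde f(t)](\tilde x,\tilde v)=\omega_c\,{}^\bot\nabla_{\tilde v}\tilde\phi[\tilde f(t)](\tilde x,\tilde v),$$ where the electric potential is $$\tilde\phi[\tilde f(t)](\tilde x,\tilde v)=\int_{\mathbb{R}^2}\int_{\mathbb{R}^2}\left\{e\left(\frac{\tilde v-\tilde w}{\omega_c}\right)\mathbf{1}_{\{|\tilde x-\tilde y|\le|\tilde v-\tilde w|/|\omega_c|\}}+e(\tilde x-\tilde y)\,\mathbf{1}_{\{|\tilde x-\tilde y|>|\tilde v-\tilde w|/|\omega_c|\}}\right\}\tilde f(t,\tilde y,\tilde w)\,\mathrm{d}\tilde w\,\mathrm{d}\tilde y.$$ *)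

(* Defs.v *)
From HB Require Import structures.
From mathcomp Require Import all_boot all_order all_algebra.
From mathcomp Require Import all_classical all_reals all_analysis.
Set Implicit Arguments.
Unset Strict Implicit.
Unset Printing Implicit Defensive.
Import Order.TTheory GRing.Theory Num.Theory.
Import numFieldNormedType.Exports.
Local Open Scope classical_set_scope.
Local Open Scope ring_scope.

Definition plane (R : realType) := (R * R)%type.
Definition phase (R : realType) := (plane R * plane R)%type.

Notation leb2 := (lebesgue_measure \x lebesgue_measure)%E.
Notation leb4 := (leb2 \x leb2)%E.

Section Defs.
Context {R : realType}.
Implicit Types (x y v w z : plane R).

(* Euclidean norm; the library norm on R * R is the max norm. *)
Definition enorm z : R := Num.sqrt (z.1 ^+ 2 + z.2 ^+ 2).

Definition dot z w : R := z.1 * w.1 + z.2 * w.2.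

Definition perp v : plane R := (v.2, - v.1).

Definition grad (h : plane R -> R) z : plane R :=
  ('D_((1, 0) : plane R) h z, 'D_((0, 1) : plane R) h z).

(* The value at z = 0 is irrelevant: it only matters on a null set. *)
Definition green z : R := - (2 * pi)^-1 * ln (enorm z).

Definition pot_kernel (wc : R) x v y w : R :=
  green (wc^-1 *: (v - w)) * (enorm (x - y) <= enorm (v - w) / `|wc|)%R%:R
  + green (x - y) * (enorm (v - w) / `|wc| < enorm (x - y))%R%:R.

Definition potential (wc : R) (g : plane R -> plane R -> R) x v : R :=
  \int[leb2]_y \int[leb2]_w (pot_kernel wc x v y w * g y w).

Definition fieldV (wc : R) (g : plane R -> plane R -> R) x v : plane R :=
  (- wc^-1) *: perp (grad (fun x' => potential wc g x' v) x).

Definition fieldA (wc : R) (g : plane R -> plane R -> R) x v : plane R :=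
  wc *: perp (grad (fun v' => potential wc g x v') v).

(* Difference quotients along R_+ = [0, +oo[ : the limit is the usual
   derivative at t > 0 and the right derivative at t = 0. *)
Definition Rplus : set R := [set t | 0 <= t].

Definition diff_quot_lim (h : R -> R) (t : R) : set_system R :=
  (h s - h t) / (s - t) @[s --> within Rplus t^'].

Definition dRplus (h : R -> R) (t : R) : R := lim (diff_quot_lim h t).

Definition is_dRplus (h : R -> R) (t l : R) : Prop := diff_quot_lim h t --> l.

Definition continuous_Rplus (h : R -> plane R -> plane R -> R) : Prop :=
  {within Rplus `*` [set: phase R],
    continuous (fun p : R * phase R => h p.1 p.2.1 p.2.2)}.

(* Class C^1 on R_+ x R^2 x R^2, through continuous partial derivatives. *)
Record C1_Rplus (f : R -> plane R -> plane R -> R) : Prop := {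
  C1_cont : continuous_Rplus f;
  C1_dt : forall t x v, 0 <= t -> cvg (diff_quot_lim (fun s => f s x v) t);
  C1_dx : forall t x v, 0 <= t ->
    derivable (fun x' => f t x' v) x (1, 0) /\
    derivable (fun x' => f t x' v) x (0, 1);
  C1_dv : forall t x v, 0 <= t ->
    derivable (fun v' => f t x v') v (1, 0) /\
    derivable (fun v' => f t x v') v (0, 1);
  C1_dt_cont :
    continuous_Rplus (fun t x v => dRplus (fun s => f s x v) t);
  C1_dx_cont :
    continuous_Rplus (fun t x v => (grad (fun x' => f t x' v) x).1) /\
    continuous_Rplus (fun t x v => (grad (fun x' => f t x' v) x).2);
  C1_dv_cont :
    continuous_Rplus (fun t x v => (grad (fun v' => f t x v') v).1) /\
    continuous_Rplus (fun t x v => (grad (fun v' => f t x v') v).2)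
}.

(* C^oo: directional derivatives of all orders exist and are Frechet
   differentiable. *)
Definition smooth (g : phase R -> R) : Prop :=
  forall (s : seq (phase R)) (p : phase R),
    differentiable (foldr (fun u h => 'D_u h) g s) p.

Definition compactly_supported (g : phase R -> R) : Prop :=
  compact (closure [set p | g p != 0]).

(* Classical solutions: f is of class C^1 on R_+ x R^2 x R^2, its L^oo and L^1
   norms in (x, v) are bounded on bounded time intervals, and the integrals
   defining the potential converge absolutely.  Every C^1 function whose support
   in (x, v) is bounded uniformly on bounded time intervals meets these growth
   conditions; conversely they bound the fields, so that a solution with
   compactly supported data keeps a bounded support. *)
Record solution (wc : R) (fin : plane R -> plane R -> R)
    (f : R -> plane R -> plane R -> R) : Prop := {
  sol_C1 : C1_Rplus f;
  sol_bounded : forall T : R, exists C : R,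
    forall t x v, 0 <= t <= T -> `|f t x v| <= C;
  sol_L1 : forall T : R, exists C : R, forall t, 0 <= t <= T ->
    (\int[leb4]_p `|f t p.1 p.2|%:E <= C%:E)%E;
  sol_potential : forall t x v, 0 <= t ->
    leb4.-integrable setT
      (fun p => (pot_kernel wc x v p.1 p.2 * f t p.1 p.2)%:E);
  sol_eq : forall t x v, 0 <= t ->
    dRplus (fun s => f s x v) t
    + dot (fieldV wc (f t) x v) (grad (fun x' => f t x' v) x)
    + dot (fieldA wc (f t) x v) (grad (fun v' => f t x v') v) = 0;
  sol_init : forall x v, f 0 x v = fin (x - wc^-1 *: perp v) v
}.

Definition energy (wc : R) (g : plane R -> plane R -> R) : R :=
  2^-1 * \int[leb2]_x \int[leb2]_v (potential wc g x v * g x v).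
End Defs.

(* Main.v *)
(* The kernel of the potential is [- (2 pi)^-1 ln N (z - z')] on the phase space
   R^4, where [N (x, v) = max (|x|, |v| / |wc|)] is a norm: it is even and its
   singularity is logarithmic.  As [1 / N] is locally integrable in R^4, the
   potential of a bounded integrable density is Lipschitz, so both fields are
   bounded and the solution keeps a bounded support (maximum principle on a
   backward cone).  By symmetry of the kernel,
     [E(s) - E(t) = 1/2 \int (phi_s + phi_t) (f_s - f_t)],
   hence [E'(t) = \int phi d_t f].  By the equation the integrand is a combination
   of the Jacobians of [f] and [phi ^ 2] in the variables [x] and [v].  Such a
   Jacobian has integral zero when [f] has bounded support: replacing the
   derivatives by central differences, this is the translation invariance of the
   Lebesgue measure, so no second derivative of [phi] is needed. *)
Require Import Defs.
From HB Require Import structures.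
From mathcomp Require Import all_boot all_order all_algebra.
From mathcomp Require Import all_classical all_reals all_analysis.
From mathcomp Require Import measurable_realfun ring lra.
Import Order.TTheory GRing.Theory Num.Theory.
Import numFieldNormedType.Exports.
Local Open Scope classical_set_scope.
Local Open Scope ring_scope.

(* [T4 R] is [phase R] with the product sigma-algebra on which [leb4] lives; the
   canonical measurable structure of [R * R] has a different display. *)
Notation TR R := (measurableTypeR R).
Notation T2 R := (TR R * TR R)%type.
Notation T4 R := (T2 R * T2 R)%type.

(** * Lebesgue measure on the phase space *)

Section PhaseMeasure.
Context {R : realType}.
Implicit Types (r : R).

(** The shape of the proof comes from the order in which regularity becomes available. A solution is
    only of class [C^1] and its support is not assumed bounded, so at first the potential is merely
    Lipschitz: its gradient is not known to exist, let alone to be continuous, and there are no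
    characteristics to follow. The maximum principle asks only for a bounded field. Once the support
    is bounded, derivatives can be moved onto the density inside the convolution, and the potential
    acquires genuine first derivatives. The norm [N] matters only up to equivalence with the max
    norm, whose balls are cubes of volume [(2 * r) ^ 4]; local integrability of [1 / |z|] is a
    dyadic sum over such cubes. After that, the kernel is handled through the record [log_singular]
    alone. Limits in time go through sequences, to which dominated convergence applies. *)

Definition cball1 (c : R) r : set (TR R) := [set x : R | `|c - x| <= r].
Definition cball2 (c : plane R) r : set (T2 R) := [set z : plane R | `|c - z| <= r].
Definition cball4 (c : phase R) r : set (T4 R) := [set z : phase R | `|c - z| <= r].

Lemma cball1E c r : cball1 c r = [set` `[c - r, c + r]].
Proof. by apply/seteqP; split => x; rewrite /cball1/= in_itv/= ler_norml; lra. Qed.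

Lemma cball2E c r : cball2 c r = cball1 c.1 r `*` cball1 c.2 r.
Proof.
apply/predeqP => x; rewrite /cball2 /cball1/= prod_normE ge_max/=.
by split => [/andP|?]; last exact/andP.
Qed.

Lemma cball4E c r : cball4 c r = cball2 c.1 r `*` cball2 c.2 r.
Proof.
apply/predeqP => x; rewrite /cball4 /cball2/= prod_normE ge_max/=.
by split => [/andP|?]; last exact/andP.
Qed.

Lemma measurable_cball1 c r : measurable (cball1 c r).
Proof. by rewrite cball1E; exact: measurable_itv. Qed.

Lemma measurable_cball2 c r : measurable (cball2 c r).
Proof. by rewrite cball2E; apply: measurableX; exact: measurable_cball1. Qed.

Lemma measurable_cball4 c r : measurable (cball4 c r).
Proof. by rewrite cball4E; apply: measurableX; exact: measurable_cball2. Qed.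

Lemma lebesgue_measure_cball1 c r : 0 <= r ->
  lebesgue_measure (cball1 c r) = (2 * r)%:E.
Proof.
move=> r0; rewrite cball1E lebesgue_measure_itv/= lte_fin; case: ltP => h.
  by rewrite -EFinD; congr EFin; ring.
by congr EFin; lra.
Qed.

(* [mu2] and [mu4] are convertible to [leb2] and [leb4]: product measures have no
   canonical sigma-finite structure, which is needed for Fubini's theorem. *)
Definition mu2 : set (T2 R) -> \bar R := (lebesgue_measure \x lebesgue_measure)%E.
HB.instance Definition _ := Measure.on mu2.

Lemma mu2X (A B : set (TR R)) : measurable A -> measurable B ->
  mu2 (A `*` B) = (lebesgue_measure A * lebesgue_measure B)%E.
Proof. by move=> mA mB; rewrite [LHS]product_measure1E. Qed.

Lemma mu2_cball c r : 0 <= r -> mu2 (cball2 c r) = ((2 * r) ^+ 2)%:E.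
Proof.
move=> r0; rewrite cball2E mu2X; do ?exact: measurable_cball1.
by rewrite !lebesgue_measure_cball1// -EFinM.
Qed.

Lemma mu2_sigma_finite : sigma_finite setT mu2.
Proof.
exists (fun n => cball2 0 n%:R).
  apply/seteqP; split => // z _; exists (Num.truncn `|z : plane R|).+1 => //.
  by rewrite /cball2/= sub0r normrN ltW// truncnS_gt.
move=> n; split; first exact: measurable_cball2.
by rewrite mu2_cball// ltry.
Qed.

HB.instance Definition _ := Measure_isSigmaFinite.Build _ _ _ mu2 mu2_sigma_finite.

Definition mu4 : set (T4 R) -> \bar R := (mu2 \x mu2)%E.
HB.instance Definition _ := Measure.on mu4.

Lemma mu4X (A B : set (T2 R)) : measurable A -> measurable B ->
  mu4 (A `*` B) = (mu2 A * mu2 B)%E.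
Proof. by move=> mA mB; rewrite [LHS]product_measure1E. Qed.

Lemma mu4_cball c r : 0 <= r -> mu4 (cball4 c r) = ((2 * r) ^+ 4)%:E.
Proof.
move=> r0; rewrite cball4E mu4X; do ?exact: measurable_cball2.
by rewrite !mu2_cball// -EFinM -exprD.
Qed.

Lemma mu4_sigma_finite : sigma_finite setT mu4.
Proof.
exists (fun n => cball4 0 n%:R).
  apply/seteqP; split => // z _; exists (Num.truncn `|z : phase R|).+1 => //.
  by rewrite /cball4/= sub0r normrN ltW// truncnS_gt.
move=> n; split; first exact: measurable_cball4.
by rewrite mu4_cball// ltry.
Qed.

HB.instance Definition _ := Measure_isSigmaFinite.Build _ _ _ mu4 mu4_sigma_finite.

Section MeasurePreserving.
Variables (d : measure_display) (T : measurableType d).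
Variables (f : T -> T) (mf : measurable_fun setT f) (mu : {measure set T -> \bar R}).
Hypothesis muf : forall A, measurable A -> mu (f @^-1` A) = mu A.

Lemma ge0_integral_preserving (h : T -> \bar R) : measurable_fun setT h ->
  (forall x, 0 <= h x)%E -> (\int[mu]_x h (f x) = \int[mu]_x h x)%E.
Proof.
move=> mh h0; rewrite -[LHS](@ge0_integral_pushforward _ _ _ _ _ _ mf mu setT h)//.
by apply: eq_measure_integral => A mA _; exact: muf.
Qed.

Lemma integral_preserving (h : T -> \bar R) : measurable_fun setT h ->
  mu.-integrable setT (fun x => h (f x)) -> (\int[mu]_x h (f x) = \int[mu]_x h x)%E.
Proof.
move=> mh h0; rewrite -[LHS](@integral_pushforward _ _ _ _ _ _ mf mu setT h)//.
by apply: eq_measure_integral => A mA _; exact: muf.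
Qed.

Lemma integrable_preserving (h : T -> \bar R) :
  mu.-integrable setT h -> mu.-integrable setT (fun x => h (f x)).
Proof.
move=> /integrableP[mh ih]; apply/integrableP; split.
  exact: measurableT_comp.
rewrite (ge0_integral_preserving (fun x => `|h x|)%E)//.
exact: measurableT_comp.
Qed.

End MeasurePreserving.

Lemma measurable_shift1 (a : R) : measurable_fun setT ((fun x => x + a) : TR R -> TR R).
Proof. exact: (@measurable_funD _ (TR R) R setT id (cst a)). Qed.

(** Lebesgue measure is determined by its values on half-open intervals, whose lengths a translation
    preserves. *)
Lemma lebesgue_measure_shift (a : R) (A : set (TR R)) : measurable A ->
  lebesgue_measure ((fun x => x + a) @^-1` A) = lebesgue_measure A.
Proof.
pose s : TR R -> TR R := fun x => x + a.
have ms : measurable_fun setT s by exact: measurable_shift1.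
move=> mA.
pose sM := isMeasurableFun.Build _ _ _ _ s ms.
pose sP : {mfun TR R >-> TR R} := HB.pack s sM.
rewrite [RHS](@lebesgue_measure_unique R (pushforward lebesgue_measure sP))//.
move=> _ [[x y] _ <-]/=; rewrite /pushforward/= (_ : _ @^-1` _ = [set` `]x - a, y - a]]);
  last first.
  by apply/seteqP; split => z; rewrite /s/= !in_itv/=; lra.
rewrite !lebesgue_measure_itv/= !lte_fin ltrD2r; case: ifP => // _.
by rewrite -!EFinD; congr EFin; ring.
Qed.

Lemma measurable_shift2 (a : plane R) :
  measurable_fun setT ((fun z : plane R => z + a) : T2 R -> T2 R).
Proof.
apply/measurable_fun_pair.
- exact: (measurableT_comp (measurable_shift1 a.1) measurable_fst).
- exact: (measurableT_comp (measurable_shift1 a.2) measurable_snd).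
Qed.

Lemma measurable_shift4 (a : phase R) :
  measurable_fun setT ((fun z : phase R => z + a) : T4 R -> T4 R).
Proof.
apply/measurable_fun_pair.
- exact: (measurableT_comp (measurable_shift2 a.1) measurable_fst).
- exact: (measurableT_comp (measurable_shift2 a.2) measurable_snd).
Qed.

(** The pushforward under the translation agrees with [mu2] on rectangles, and the product measure
    is unique. *)
Lemma mu2_shift (a : plane R) (A : set (T2 R)) : measurable A ->
  mu2 ((fun z : plane R => z + a) @^-1` A) = mu2 A.
Proof.
pose s : T2 R -> T2 R := fun z : plane R => z + a.
have ms : measurable_fun setT s by exact: measurable_shift2.
pose sM := isMeasurableFun.Build _ _ _ _ s ms.
pose sP : {mfun T2 R >-> T2 R} := HB.pack s sM.
move=> mA; rewrite [RHS](product_measure_unique (m' := pushforward mu2 sP))//.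
move=> B C mB mC; 
transitivity (mu2 (((fun x => x + a.1) @^-1` B) `*` ((fun x => x + a.2) @^-1` C))) => //.
rewrite mu2X.
by rewrite !lebesgue_measure_shift.
rewrite -[X in measurable X]setTI; exact: measurable_shift1.
rewrite -[X in measurable X]setTI; exact: measurable_shift1.
Qed.

Lemma mu4_shift (a : phase R) (A : set (T4 R)) : measurable A ->
  mu4 ((fun z : phase R => z + a) @^-1` A) = mu4 A.
Proof.
pose s : T4 R -> T4 R := fun z : phase R => z + a.
have ms : measurable_fun setT s by exact: measurable_shift4.
pose sM := isMeasurableFun.Build _ _ _ _ s ms.
pose sP : {mfun T4 R >-> T4 R} := HB.pack s sM.
move=> mA; rewrite [RHS](product_measure_unique (m' := pushforward mu4 sP))//.
move=> B C mB mC; 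
transitivity (mu4 (((fun x : plane R => x + a.1) @^-1` B) `*` ((fun x : plane R => x + a.2)
  @^-1` C))) => //.
rewrite mu4X.
by rewrite !mu2_shift.
rewrite -[X in measurable X]setTI; exact: measurable_shift2.
rewrite -[X in measurable X]setTI; exact: measurable_shift2.
Qed.

Lemma Rintegral_shift4 (h : phase R -> R) (c : phase R) :
  mu4.-integrable setT (EFin \o h) ->
  \int[mu4]_y h (y + c) = \int[mu4]_y h y.
Proof.
move=> ih; rewrite /Rintegral; congr fine.
pose s : T4 R -> T4 R := fun y : phase R => y + c.
have ms : measurable_fun setT s := measurable_shift4 c.
have sE A : measurable A -> mu4 (s @^-1` A) = mu4 A by move=> mA; exact: mu4_shift.
apply: (integral_preserving _ _ s ms mu4 sE _ (measurable_int _ ih)).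
exact: (integrable_preserving _ _ s ms mu4 sE _ ih).
Qed.

(** The sigma-algebra of [T4 R] comes from rectangles, so its relation to the topology has to be
    proved: an open set is the union of the countably many closed cubes of rational centre and
    radius [1 / (n + 1)] that it contains. *)
Lemma open_measurable4 (U : set (phase R)) : open U -> measurable (U : set (T4 R)).
Proof.
move=> oU.
pose q4 (a b c e : rat) : phase R := ((ratr a, ratr b), (ratr c, ratr e)).
pose F a b c e n : set (T4 R) :=
  if `[< cball4 (q4 a b c e) n.+1%:R^-1 `<=` U >] then cball4 (q4 a b c e) n.+1%:R^-1 else set0.
rewrite (_ : U = \bigcup_(a in @setT rat) \bigcup_(b in @setT rat)
   \bigcup_(c in @setT rat) \bigcup_(e in @setT rat) \bigcup_n F a b c e n).
  do 4 ! apply: bigcupT_measurable_rat => ?.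
  apply: bigcupT_measurable => n; rewrite /F; case: ifP => // _.
  exact: measurable_cball4.
apply/seteqP; split => [z Uz|z [a _ [b _ [c _ [e _ [n _]]]]]]; last first.
  by rewrite /F; case: ifPn => // /asboolP; exact.
have /nbhs_ballP[/= r r0 rU] : nbhs z U by exact: open_nbhs_nbhs.
(* A cube of radius below [r / 2] that contains [z] lies in the ball of radius [r] around [z]. *)
have [n nr] : exists n, n.+1%:R^-1 < r / 2.
  exists (Num.truncn (r / 2)^-1).
  by rewrite invf_plt ?posrE ?divr_gt0// truncnS_gt.
have n0 : 0 < n.+1%:R^-1 :> R by rewrite invr_gt0.
have H (x : R) : exists q : rat, `|ratr q - x| <= n.+1%:R^-1.
  move: (n.+1%:R^-1 : R) n0 => d d0.
  have : x - d < x + d by lra.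
  move=> /rat_in_itvoo[q]; rewrite in_itv/= => qx; exists q.
  by rewrite ler_norml; lra.
have [[a Ha] [b Hb]] := (H z.1.1, H z.1.2).
have [[c Hc] [e He]] := (H z.2.1, H z.2.2).
have zq : cball4 (q4 a b c e) n.+1%:R^-1 z.
  by rewrite /cball4/= !prod_normE !ge_max; apply/andP; split; apply/andP.
exists a => //; exists b => //; exists c => //; exists e => //; exists n => //.
rewrite /F ifT//; apply/asboolP => y qy; apply: rU.
rewrite -ball_normE /ball_/=.
rewrite (_ : z - y = (z - q4 a b c e) + (q4 a b c e - y)); last by rewrite addrA subrK.
rewrite (le_lt_trans (ler_normD _ _))// (_ : r = r / 2 + r / 2); last by field.
by rewrite ltrD// (le_lt_trans _ nr)// distrC.
Qed.

Lemma continuous_measurable4 (f : phase R -> R) :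
  continuous f -> measurable_fun setT (f : T4 R -> R).
Proof.
move=> /continuousP cf; apply: (measurability _ (RGenOpens.measurableE R)).
move=> _ [_ [a [b ->] <-]]; rewrite setTI; apply: open_measurable4.
exact/cf/interval_open.
Qed.

End PhaseMeasure.

(** * The logarithmic kernel *)

Section InverseNorm.
Context {R : realType}.
Implicit Types (z : phase R).

Lemma measurable_dist4 z : measurable_fun setT ((fun y : phase R => `|z - y|) : T4 R -> R).
Proof.
apply: continuous_measurable4 => y.
by apply: cvg_norm; apply: cvgB; [exact: cvg_cst|exact: cvg_id].
Qed.

(** Inversion is discontinuous at 0, so continuity does not apply; on nonnegative reals it is the
    power of exponent [-1], which is measurable. *)
Lemma measurable_inv_dist4 z :
  measurable_fun setT ((fun y : phase R => `|z - y|^-1) : T4 R -> R).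
Proof.
rewrite (_ : (fun _ => _) = (fun y : phase R => `|z - y| `^ (-1))).
  exact: (measurableT_comp (@measurable_powR R (-1)) (measurable_dist4 z)).
by apply/funext => y; rewrite powR_inv1.
Qed.

(** On the ball of radius [2 ^ - k] the weight [2 ^ (k + 1)] will dominate [1 / d]. The index comes
    from the least [n] with [d^-1 <= 2 ^ n]. *)
Lemma dyadic_shell (d : R) : 0 < d <= 1 ->
  exists k, d <= (2 ^+ k)^-1 /\ d^-1 <= 2 ^+ k.+1.
Proof.
move=> /andP[d0 d1].
have : exists n, d^-1 <= 2 ^+ n.
  exists (Num.truncn d^-1).+1; apply: (le_trans (ltW (truncnS_gt _))).
  by rewrite -natrX ler_nat ltnW// ltn_expl.
move=> /ex_minnP[[|k] hk kmin].
  exists 0; rewrite expr0 invr1; split => //; apply: (le_trans hk).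
  by rewrite expr0 exprS expr0 mulr1; lra.
exists k; split => //; rewrite leNgt; apply/negP => dk.
suff : (k.+1 <= k)%N by rewrite ltnn.
apply: kmin; rewrite -[leRHS]invrK lef_pV2 ?posrE ?invr_gt0 ?exprn_gt0//.
exact: ltW.
Qed.

(** The integrand is dominated by the sum over [k] of [2 ^ (k + 1)] times the indicator of the ball
    of radius [2 ^ - k]. The [k]-th term has integral [32 * 2 ^ (- 3 k)], which is at most
    [64 / 2 ^ (k + 1)], and these bounds add up to 64. *)
Lemma integral_inv_dist_cball z :
  (\int[mu4]_y (`|(z : phase R) - y|^-1 * \1_(cball4 z 1) y)%:E <= 64%:E)%E.
Proof.
pose u k (y : T4 R) : \bar R := (2 ^+ k.+1 * \1_(cball4 z (2 ^+ k)^-1) y)%:E.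
have mi k : measurable_fun [set: T4 R] (fun y => (\1_(cball4 z (2 ^+ k)^-1) y : R)%:E).
  apply/measurable_EFinP; apply: measurable_indic; exact: measurable_cball4.
have mu_ k : measurable_fun [set: T4 R] (u k).
  apply/measurable_EFinP; apply: measurable_funM => //.
  by apply: measurable_indic; exact: measurable_cball4.
have u0 k y : (0 <= u k y)%E.
  by rewrite /u lee_fin mulr_ge0.
apply: (@le_trans _ _ (\int[mu4]_y \sum_(0 <= k <oo) u k y)%E).
  apply: ge0_le_integral => //.
  - apply/measurable_EFinP; apply: measurable_funM.
      exact: measurable_inv_dist4.
    by apply: measurable_indic; exact: measurable_cball4.
  - by apply: ge0_emeasurable_sum => //.
  - move=> y _; rewrite indicE; case: (boolP (y \in cball4 z 1)) => [|_]; last first.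
      by rewrite mulr0; apply: nneseries_ge0.
    rewrite inE /cball4/= mulr1 => zy.
    (* At [y = z] the integrand is 0, because [0^-1 = 0]. *)
    have [->|d0] := eqVneq `|(z : phase R) - y| 0.
      by rewrite invr0; apply: nneseries_ge0.
    have [|k [k1 k2]] := @dyadic_shell `|(z : phase R) - y|.
      by rewrite zy lt_neqAle eq_sym d0 normr_ge0.
    rewrite (@nneseries_split _ _ 0 k.+1)// add0n big_nat_recr//=.
    rewrite -[leLHS]add0e -[leLHS]adde0; apply: leeD; last exact: nneseries_ge0.
    apply: leeD; first exact: sume_ge0.
    by rewrite /u indicE mem_set// mulr1 lee_fin.
rewrite integral_nneseries//.
apply: le_trans (@epsilon_trick0 R 64 xpredT _) => //.
apply: lee_nneseries => k _ => [_|]; first by apply: integral_ge0 => y _; exact: u0.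
under eq_integral do rewrite /u EFinM.
rewrite ge0_integralZl_EFin//.
rewrite integral_indic//.
rewrite setIT [X in (_ * X <= _)%E]mu4_cball// -EFinM lee_fin natrX.
set x : R := 2 ^+ k; have x1 : 1 <= x by rewrite exprn_ege1// ler1n.
have x0 : 0 < x by exact: lt_le_trans x1.
rewrite [2 ^+ k.+1]exprS -/x (_ : 2 * x * (2 * x^-1) ^+ 4 = 32 / x / x ^+ 2); last first.
  by field; rewrite gt_eqF.
rewrite (_ : 64 / (2 * x) = 32 / x); last by field; rewrite gt_eqF.
rewrite ler_pdivrMr ?exprn_gt0//; apply: ler_peMr; last exact: exprn_ege1.
by rewrite divr_ge0 ?ltW.
exact: measurable_cball4.
Qed.
End InverseNorm.

(** * The weighted norm and its logarithm *)

Section Kernel.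
Context {R : realType}.

Lemma lipschitz_continuous (V : normedModType R) (f : V -> R) (L : R) :
  (forall a b, `|f a - f b| <= L * `|a - b|) -> continuous f.
Proof.
move=> fL a; apply/cvgrPdist_le => e e0.
have L0 : 0 < `|L| + 1 by rewrite ltr_wpDl.
near=> b; apply: (le_trans (fL a b)).
apply: (@le_trans _ _ ((`|L| + 1) * `|a - b|)).
  by rewrite ler_wpM2r// (le_trans (ler_norm L))// lerDl.
rewrite -ler_pdivlMl//; near: b.
apply/nbhs_ballP; exists ((`|L| + 1)^-1 * e); first by rewrite /= mulr_gt0// invr_gt0.
by move=> y; rewrite -ball_normE => /ltW.
Unshelve. all: by end_near. Qed.

Implicit Types (z a b : plane R).

Lemma enorm_ge0 z : 0 <= enorm z. Proof. exact: sqrtr_ge0. Qed.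

Lemma enorm_sqr z : enorm z ^+ 2 = z.1 ^+ 2 + z.2 ^+ 2.
Proof. by rewrite sqr_sqrtr// addr_ge0// sqr_ge0. Qed.

Lemma enormZ (k : R) z : enorm (k *: z) = `|k| * enorm z.
Proof.
rewrite /enorm/= -sqrtr_sqr -sqrtrM ?sqr_ge0//; congr Num.sqrt.
by rewrite /GRing.scale/=; ring.
Qed.

Lemma enormN z : enorm (- z) = enorm z.
Proof. by rewrite -scaleN1r enormZ normrN1 mul1r. Qed.

Lemma enormD a b : enorm (a + b) <= enorm a + enorm b.
Proof.
rewrite -(@ler_pXn2r _ 2)// ?nnegrE ?addr_ge0 ?enorm_ge0//.
rewrite sqrrD !enorm_sqr/=.
suff : a.1 * b.1 + a.2 * b.2 <= enorm a * enorm b by lra.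
rewrite (le_trans (ler_norm _))// -(@ler_pXn2r _ 2)// ?nnegrE ?mulr_ge0 ?enorm_ge0//.
rewrite real_normK ?num_real// exprMn !enorm_sqr -subr_ge0.
rewrite (_ : _ - _ = (a.1 * b.2 - a.2 * b.1) ^+ 2) ?sqr_ge0//; ring.
Qed.

Lemma le_norm_enorm z : `|z| <= enorm z.
Proof.
rewrite prod_normE ge_max; apply/andP; split.
  rewrite -(@ler_pXn2r _ 2)// ?nnegrE ?enorm_ge0// enorm_sqr real_normK ?num_real//.
  by rewrite lerDl sqr_ge0.
rewrite -(@ler_pXn2r _ 2)// ?nnegrE ?enorm_ge0// enorm_sqr real_normK ?num_real//.
by rewrite lerDr sqr_ge0.
Qed.

Lemma enorm_le_norm z : enorm z <= 2 * `|z|.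
Proof.
rewrite -(@ler_pXn2r _ 2)// ?nnegrE ?enorm_ge0 ?mulr_ge0// enorm_sqr exprMn.
have := normr_ge0 z; set m := `|z| => m0.
have [h1 h2] : `|z.1| <= m /\ `|z.2| <= m.
  by rewrite /m prod_normE !le_max !lexx orbT.
have l1 : z.1 ^+ 2 <= m ^+ 2 by rewrite -real_normK ?num_real// ler_pXn2r ?nnegrE.
have l2 : z.2 ^+ 2 <= m ^+ 2 by rewrite -real_normK ?num_real// ler_pXn2r ?nnegrE.
nra.
Qed.

Definition wnorm (wc : R) (z : phase R) : R := Num.max (enorm z.1) (enorm z.2 / `|wc|).

Definition logker (wc : R) (z : phase R) : R := - (2 * pi)^-1 * ln (wnorm wc z).

(** The two indicators select the larger of [|x - y|] and [|v - w| / |wc|], so both branches are the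
    same logarithm of a maximum. *)
Lemma pot_kernelE wc x v y w : pot_kernel wc x v y w = logker wc ((x, v) - (y, w)).
Proof.
rewrite /pot_kernel /green /logker /wnorm/= enormZ normfV mulrC [_^-1 * enorm _]mulrC.
by case: leP => h; rewrite !(mulr1, mulr0, mul1r, mul0r, addr0, add0r).
Qed.

Variables (wc : R) (wc0 : wc != 0).

Let awc0 : 0 < `|wc|. Proof. by rewrite normr_gt0. Qed.

Lemma wnorm_ge0 (z : phase R) : 0 <= wnorm wc z.
Proof. by rewrite le_max enorm_ge0. Qed.

Lemma wnormN (z : phase R) : wnorm wc (- z) = wnorm wc z.
Proof. by rewrite /wnorm/= !enormN. Qed.

Lemma wnormD (a b : phase R) : wnorm wc (a + b) <= wnorm wc a + wnorm wc b.
Proof.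
rewrite ge_max; apply/andP; split.
  by rewrite (le_trans (enormD _ _))// lerD// le_max lexx.
rewrite ler_pdivrMr// (le_trans (enormD _ _))// mulrDl.
by rewrite lerD// -ler_pdivrMr// le_max lexx orbT.
Qed.

Lemma wnorm_equiv : exists c C : R, [/\ 0 < c, 0 < C,
  (forall z : phase R, c * `|z| <= wnorm wc z) & forall z : phase R, wnorm wc z <= C * `|z|].
Proof.
have i0 : 0 < `|wc|^-1 by rewrite invr_gt0.
exists (Num.min 1 `|wc|^-1), (2 * (1 + `|wc|^-1)).
split => [| |z|z]; first by rewrite lt_min ltr01.
- by rewrite mulr_gt0// addr_gt0.
- have m0 : 0 <= Num.min 1 `|wc|^-1 by rewrite le_min ler01 ltW.
  have m1 : Num.min 1 `|wc|^-1 <= 1 by rewrite ge_min lexx.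
  have m2 : Num.min 1 `|wc|^-1 <= `|wc|^-1 by rewrite ge_min lexx orbT.
  rewrite [`|z|]prod_normE; have [zz|zz] := leP `|z.1| `|z.2|.
    rewrite le_max; apply/orP; right; rewrite mulrC.
    exact: (ler_pM _ _ (le_norm_enorm _)).
  rewrite le_max; apply/orP; left; rewrite -[leRHS]mul1r.
  exact: (ler_pM _ _ _ (le_norm_enorm _)).
- have [h1 h2] : `|z.1| <= `|z| /\ `|z.2| <= `|z|.
    by split; rewrite [`|z|]prod_normE/= le_max lexx ?orbT.
  rewrite ge_max; apply/andP; split.
    apply: (le_trans (enorm_le_norm _)); rewrite -mulrA ler_pM2l// mulrDl mul1r.
    by rewrite (le_trans h1)// lerDl mulr_ge0// ltW.
  rewrite mulrC (@le_trans _ _ (`|wc|^-1 * (2 * `|z|)))//.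
    by rewrite ler_pM2l// (le_trans (enorm_le_norm _))// ler_pM2l.
  rewrite [leRHS](_ : _ = `|wc|^-1 * (2 * `|z|) + 2 * `|z|); last by ring.
  by rewrite lerDl mulr_ge0.
Qed.

Lemma wnorm0 : wnorm wc 0 = 0.
Proof.
have [c [C [_ _ _ h]]] := wnorm_equiv.
by apply/eqP; rewrite eq_le wnorm_ge0 andbT (le_trans (h 0))// normr0 mulr0.
Qed.

Lemma wnorm_lip (a b : phase R) : `|wnorm wc a - wnorm wc b| <= wnorm wc (a - b).
Proof.
have := wnormD (a - b) b; have := wnormD (b - a) a.
by rewrite !subrK -[wnorm wc (b - a)]wnormN opprB ler_norml; lra.
Qed.

(** The bound [ln (1 + s) <= s] with [s = (u - v) / v], used in both directions; adding the two
    inverses makes the estimate symmetric and free of intermediate points. *)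
Lemma ler_norm_lnB (x y : R) : 0 < x -> 0 < y ->
  `|ln x - ln y| <= `|x - y| * (x^-1 + y^-1).
Proof.
have H (u v : R) : 0 < u -> 0 < v -> ln u - ln v <= `|u - v| * (u^-1 + v^-1).
  move=> u0 v0; rewrite -ln_div ?posrE//.
  rewrite (_ : u / v = 1 + (u - v) / v); last by field; rewrite gt_eqF.
  apply: (le_trans (le_ln1Dx _)).
    by rewrite ltr_pdivlMr//; lra.
  apply: (@le_trans _ _ (`|u - v| / v)).
    by rewrite ler_pM2r ?invr_gt0// ler_norm.
  by rewrite ler_wpM2l// lerDr invr_ge0 ltW.
move=> x0 y0; have := H _ _ x0 y0; have := H _ _ y0 x0.
by rewrite distrC [y^-1 + _]addrC ler_norml; lra.
Qed.

(** Apply [ln x < x] to [x] and to [x^-1]. At 0 both sides vanish by the conventions for [ln] and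
    the inverse. *)
Lemma ler_norm_ln (x : R) : 0 <= x -> `|ln x| <= x + x^-1.
Proof.
rewrite le_eqVlt => /predU1P[<-|x0]; first by rewrite ln0// normr0 invr0 addr0.
have := ln_sublinear x0; have : 0 < x^-1 by rewrite invr_gt0.
by move=> xi; have := ln_sublinear xi; rewrite lnV ?posrE// ler_norml; lra.
Qed.

End Kernel.

(** What the analysis uses of the kernel, in the max norm. The last field is the gradient bound
    [C / |z|] in integrated form. With [0^-1 = 0] the growth bound also covers the origin, where it
    forces [k 0 = 0]. *)
Record log_singular (R : realType) (k : phase R -> R) (C : R) : Prop := {
  log_singular_ge0 : 0 <= C;
  log_singular_meas : measurable_fun setT (k : T4 R -> R);
  log_singular_even : forall z, k (- z) = k z;
  log_singular_bound : forall z, `|k z| <= C * (`|z| + `|z|^-1);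
  log_singular_lip : forall a b, a != 0 -> b != 0 ->
    `|k a - k b| <= C * `|a - b| * (`|a|^-1 + `|b|^-1)
}.

Arguments log_singular {R} k C.
Arguments log_singular_ge0 {R k C}.
Arguments log_singular_meas {R k C}.
Arguments log_singular_even {R k C}.
Arguments log_singular_bound {R k C}.
Arguments log_singular_lip {R k C}.

Lemma logker_log_singular (R : realType) (wc : R) : wc != 0 ->
  exists C, log_singular (logker wc) C.
Proof.
move=> wc0; have [c [C [c0 C0 hc hC]]] := wnorm_equiv wc wc0.
have p0 : 0 < (2 * pi : R)^-1 by rewrite invr_gt0 mulr_gt0// pi_gt0.
set p := (2 * pi)^-1 in p0.
have inv_le z : z != 0 -> (wnorm wc z)^-1 <= c^-1 * `|z|^-1.
  move=> z0; have z1 : 0 < c * `|z| by rewrite mulr_gt0// normr_gt0.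
  by rewrite -invfM lef_pV2 ?posrE// (lt_le_trans z1).
have npos z : z != 0 -> 0 < wnorm wc z.
  by move=> z0; apply: lt_le_trans (hc z); rewrite mulr_gt0// normr_gt0.
have ic0 : 0 < c^-1 by rewrite invr_gt0.
(* [C + c^-1] serves the growth bound and [C * c^-1] the Lipschitz bound. *)
exists (p * (C + c^-1 + C * c^-1)); split.
- by rewrite mulr_ge0 ?addr_ge0 ?mulr_ge0 ?ltW.
- apply: measurable_funM => //; apply: measurableT_comp => //.
  apply: continuous_measurable4; apply: (@lipschitz_continuous _ _ _ C) => a b.
  exact: le_trans (wnorm_lip wc wc0 _ _) (hC _).
- by move=> z; rewrite /logker wnormN.
- move=> z; rewrite /logker normrM normrN (gtr0_norm p0) -mulrA ler_pM2l//.
  have [->|z0] := eqVneq z 0.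
    by rewrite (wnorm0 wc wc0) ln0// !normr0 invr0 addr0 mulr0.
  apply: (le_trans (ler_norm_ln _ (wnorm_ge0 wc z))).
  have := hC z; have := inv_le z z0.
  have i0 : 0 < `|z|^-1 by rewrite invr_gt0 normr_gt0.
  have n0 := normr_ge0 z.
  move: (`|z|) (`|z|^-1) (c^-1) (wnorm wc z) ((wnorm wc z)^-1)
    n0 i0 ic0 => n i d w v n0 i0 d0 *.
  have : 0 <= C * i by rewrite mulr_ge0 ?ltW.
  have : 0 <= d * n by rewrite mulr_ge0// ltW.
  have : 0 <= C * d * (n + i) by rewrite mulr_ge0 ?addr_ge0 ?mulr_ge0// ltW.
  lra.
- move=> a b a0 b0; rewrite /logker -mulrBr normrM normrN (gtr0_norm p0) -!mulrA ler_pM2l//.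
  apply: (le_trans (ler_norm_lnB _ _ (npos a a0) (npos b b0))).
  apply: (@le_trans _ _ ((C * `|a - b|) * (c^-1 * (`|a|^-1 + `|b|^-1)))).
    apply: ler_pM => //.
    + by rewrite addr_ge0// invr_ge0 wnorm_ge0.
    + exact: le_trans (wnorm_lip wc wc0 _ _) (hC _).
    + by rewrite mulrDr lerD// inv_le.
  rewrite mulrACA ler_wpM2r ?mulr_ge0 ?addr_ge0 ?invr_ge0//.
  by rewrite lerDr addr_ge0 ?ltW.
Qed.

(** [Rintegral] turns an infinite inner integral into 0; for an integrable [h] the inner integrals
    are finite almost everywhere, so the convention does no harm. *)
Lemma Rintegral_prod d1 d2 (T1 : measurableType d1) (T2 : measurableType d2)
    (R : realType) (m1 : {sigma_finite_measure set T1 -> \bar R})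
    (m2 : {sigma_finite_measure set T2 -> \bar R}) (h : T1 * T2 -> R) :
  (m1 \x m2)%E.-integrable setT (EFin \o h) ->
  \int[m1]_x \int[m2]_y h (x, y) = \int[(m1 \x m2)%E]_p h p.
Proof.
move=> ih; rewrite /Rintegral; congr fine.
rewrite -(integral12_prod_meas1 ih); apply: ae_eq_integral => //.
- apply/measurable_EFinP; apply: measurableT_comp => //.
  exact: measurable_fubini_F ih.
- exact: measurable_fubini_F ih.
- apply: filterS (ae_integrable1 ih) => x ix _.
  by rewrite fineK//; exact: integrable_fin_num ix.
Qed.

(* Where the directional derivative does not exist, ['D_v h x] is [0], so that no
   derivability is required. *)
Lemma norm_derive_le (R : realType) (V : normedModType R) (h : V -> R) (L : R) :
  0 <= L -> (forall a b, `|h a - h b| <= L * `|a - b|) ->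
  forall x v, `|'D_v h x| <= L * `|v|.
Proof.
move=> L0 hL x v; rewrite /derive.
set F := (X in lim X).
have [cF|/dvgP ->] := pselect (cvg F); last by rewrite normr0 mulr_ge0.
have cL : s^-1 *: (h (s *: v + x) - h x) @[s --> 0^'] --> (lim F : R) by [].
apply: (cvgr_to_le (cvg_norm cL)).
near=> s; rewrite normrZ.
apply: (@le_trans _ _ (`|s^-1| * (L * `|s *: v|))).
  by rewrite ler_wpM2l// (le_trans (hL _ _))// addrK.
have s0 : s != 0 by near: s; exact: nbhs_dnbhs_neq.
rewrite normrZ normfV [leLHS](_ : _ = L * `|v|)//.
by field; rewrite normr_eq0.
Unshelve. all: by end_near. Qed.

(** * Lipschitz bound for the potential of a bounded integrable density *)

Section Potential.
Context {R : realType}.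
Variables (k : phase R -> R) (C : R).
Hypothesis kC : log_singular k C.

Let C0 := log_singular_ge0 kC.

Lemma mu4_set1 (a : phase R) : mu4 [set a] = 0.
Proof.
rewrite (_ : [set a] = cball4 a 0); first by rewrite mu4_cball// mulr0 expr0n.
by apply/predeqP => z; rewrite /cball4/= normr_le0 subr_eq0; split => [->|/eqP].
Qed.

Lemma measurable_set1_phase (a : phase R) : measurable ([set a] : set (T4 R)).
Proof.
rewrite (_ : [set a] = cball4 a 0); first exact: measurable_cball4.
by apply/predeqP => z; rewrite /cball4/= normr_le0 subr_eq0; split => [->|/eqP].
Qed.

Lemma measurable_ker_shift (z : phase R) :
  measurable_fun [set: T4 R] (fun y : phase R => k (z - y)).
Proof.
have kE y : k (z - y) = k (y + - z).
  by rewrite -(log_singular_even kC) opprB.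
rewrite (funext kE).
exact: (measurableT_comp (log_singular_meas kC) (measurable_shift4 _)).
Qed.

(** Split at distance 1 from [a]: nearby, [|g| <= M] and the weight has integral at most 64; farther
    away the weight is at most 1, leaving the [L^1] norm. *)
Lemma integral_inv_dist_le (g : phase R -> R) (M B : R) (a : phase R) :
  measurable_fun [set: T4 R] g -> (forall z, `|g z| <= M) ->
  (\int[mu4]_y `|g y|%:E <= B%:E)%E ->
  (\int[mu4]_y (`|a - y|^-1 * `|g y|)%:E <= (64 * M + B)%:E)%E.
Proof.
move=> mg gM gB.
have M0 : 0 <= M by exact: le_trans (gM 0).
have mi : measurable_fun [set: T4 R] (fun y => `|a - y|^-1 * \1_(cball4 a 1) y).
  apply: measurable_funM; first exact: measurable_inv_dist4.
  by apply: measurable_indic; exact: measurable_cball4.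
have mng : measurable_fun [set: T4 R] (fun y => `|g y|) by exact: measurableT_comp.
apply: (@le_trans _ _ (\int[mu4]_y (M%:E * (`|a - y|^-1 * \1_(cball4 a 1)
  y)%:E + `|g y|%:E)%E)%E).
  apply: ge0_le_integral => //.
  - by apply/measurable_EFinP; apply: measurable_funM => //; exact: measurable_inv_dist4.
  - apply/measurable_EFinP/measurable_funD => //; exact: measurable_funM.
  - move=> y _; rewrite -EFinM -EFinD lee_fin indicE.
    case: (boolP (y \in cball4 a 1)) => [|]; rewrite ?inE ?notin_setE /cball4/= => ya.
      rewrite mulr1 mulrC; apply: (@le_trans _ _ (M * `|a - y|^-1)); last by rewrite lerDl.
      by rewrite ler_wpM2r.
    rewrite !mulr0 add0r -[leRHS]mul1r ler_wpM2r// -[leRHS]invr1 lef_pV2 ?posrE//.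
      by move/negP: ya; rewrite -ltNge => /ltW.
    by move/negP: ya; rewrite -ltNge; exact: lt_trans.
rewrite ge0_integralD//=.
- rewrite ge0_integralZl_EFin//.
  + rewrite EFinD EFinM [(64%:E * _)%E]muleC leeD// lee_wpmul2l ?lee_fin//.
    exact: integral_inv_dist_cball.
  + exact/measurable_EFinP.
- by move=> y _; rewrite -EFinM lee_fin !mulr_ge0.
- by apply/measurable_EFinP; exact: measurable_funM.
- exact/measurable_EFinP.
Qed.

Definition conv (g : phase R -> R) (z : phase R) : R :=
  \int[mu4]_y (k (z - y) * g y).

(** Integrate [log_singular_lip] against [g]; each of the singular points [a] and [b] costs
    [64 * M + B]. No support condition is imposed on [g], since this estimate has to precede the
    control of the support of the solution. *)
Lemma conv_lip (g : phase R -> R) (M B : R) :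
  measurable_fun [set: T4 R] g -> (forall z, `|g z| <= M) ->
  (\int[mu4]_y `|g y|%:E <= B%:E)%E ->
  (forall z, mu4.-integrable setT (fun y => (k (z - y) * g y)%:E)) ->
  forall a b, `|conv g a - conv g b| <= C * (2 * (64 * M + B)) * `|a - b|.
Proof.
move=> mg gM gB ig a b; rewrite /conv.
rewrite -RintegralB//.
have id : mu4.-integrable setT (EFin \o (fun y => k (a - y) * g y - k (b - y) * g y)).
  rewrite (_ : _ \o _ = (fun y => (k (a - y) * g y)%:E - (k (b - y) * g y)%:E)%E)//.
  by apply: integrableB.
rewrite -lee_fin EFin_normr_Rintegral//.
apply: (le_trans (le_abse_integral _ _ _)) => //; first exact: measurable_int id.
have mI c : measurable_fun [set: T4 R] (fun y => `|c - y|^-1 * `|g y|).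
  by apply: measurable_funM; [exact: measurable_inv_dist4|exact: measurableT_comp].
apply: (@le_trans _ _ (\int[mu4]_y ((C * `|a - b|)%:E *
    ((`|a - y|^-1 * `|g y|)%:E + (`|b - y|^-1 * `|g y|)%:E))%E)%E).
  apply: ae_ge0_le_integral => //.
  - by apply: measurableT_comp => //; exact: measurable_int id.
  - by move=> y _; rewrite -EFinD -EFinM lee_fin mulr_ge0 ?addr_ge0 ?mulr_ge0.
  - apply/measurable_EFinP; apply: measurable_funM => //.
    exact: measurable_funD.
  - exists ([set a] `|` [set b]); split.
    + by apply: measurableU; exact: measurable_set1_phase.
    + by rewrite null_set_setU//; [exact: measurable_set1_phase..|exact: mu4_set1|exact:
      mu4_set1].
    move=> y /=; apply: contra_notP => /not_orP[/eqP ya /eqP yb] _.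
    rewrite /= lee_fin -mulrBl normrM -mulrDl mulrA ler_wpM2r//.
    have := log_singular_lip kC (a - y) (b - y).
    rewrite !subr_eq0 eq_sym ya eq_sym yb => /(_ isT isT) /le_trans; apply.
    by rewrite opprB addrA subrK.
rewrite ge0_integralZl_EFin//.
- rewrite ge0_integralD//.
  + rewrite (_ : C * _ * _ = C * `|a - b| * ((64 * M + B) + (64 * M + B))); last by ring.
    rewrite [(_ * (_ + _))%:E]EFinM lee_wpmul2l ?lee_fin ?mulr_ge0// EFinD.
    by apply: leeD; exact: integral_inv_dist_le.
  + exact/measurable_EFinP.
  + exact/measurable_EFinP.
- by move=> y _; rewrite -EFinD lee_fin addr_ge0 ?mulr_ge0.
- by apply/measurable_EFinP; exact: measurable_funD.
- exact: mulr_ge0.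
- exact: ig.
- exact: ig.
Qed.
End Potential.

(** * Propagation of the support *)

Section Calculus.
Context {R : realType}.

Lemma is_dRplusP (h : R -> R) (t l : R) : is_dRplus h t l <->
  forall e, 0 < e -> exists2 d, 0 < d & forall s, 0 <= s -> s != t -> `|s - t| < d ->
    `|(h s - h t) / (s - t) - l| <= e.
Proof.
rewrite /is_dRplus /diff_quot_lim; split.
  move=> /cvgrPdist_le H e e0; have /nbhs_ballP[d /= d0 hd] := H _ e0.
  exists d => // s s0 st sd; rewrite distrC; apply: hd => //.
  by rewrite -ball_normE /= distrC.
move=> H; apply/cvgrPdist_le => e e0; have [d d0 hd] := H _ e0.
apply/nbhs_ballP; exists d => //= s; rewrite -ball_normE /= distrC => sd st s0.
by rewrite distrC; exact: hd.
Qed.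

Lemma is_derive_eps (h : R -> R) (t l : R) :
  (forall e, 0 < e -> exists2 d, 0 < d & forall s, s != t -> `|s - t| < d ->
    `|(h s - h t) / (s - t) - l| <= e) -> is_derive t 1 h l.
Proof.
move=> H.
have hl : (fun k : R => k^-1 *: (h (k *: 1 + t) - h t)) @ 0^' --> l.
  apply/cvgrPdist_le => e e0; have [d d0 hd] := H _ e0.
  apply/nbhs_ballP; exists d => //= s; rewrite -ball_normE /= sub0r normrN => sd s0.
  have := hd (s + t); rewrite addrK -subr_eq0 addrK distrC => /(_ s0 sd).
  by rewrite /GRing.scale/= mulr1 mulrC.
by apply: DeriveDef; [apply/cvg_ex; exists l|exact/cvg_lim].
Qed.

Lemma is_derive_dRplus (h : R -> R) (t : R) : 0 < t -> cvg (diff_quot_lim h t) ->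
  is_derive t 1 h (dRplus h t).
Proof.
move=> t0 /is_dRplusP H; apply: is_derive_eps => e e0; have [d d0 hd] := H _ e0.
exists (Num.min d t); first by rewrite lt_min d0.
by move=> s st; rewrite lt_min => /andP[sd std]; apply: hd => //; move: std;
  rewrite ltr_norml; lra.
Qed.

Lemma dRplus_cont (h : R -> R) (t : R) : cvg (diff_quot_lim h t) ->
  forall e, 0 < e -> exists2 d, 0 < d & forall s, 0 <= s -> `|s - t| < d -> `|h s - h t| <= e.
Proof.
move=> /is_dRplusP H e e0; have [d d0 hd] := H 1 ltr01.
set L := `|dRplus h t| + 1; have L0 : 0 < L by rewrite ltr_wpDl.
exists (Num.min d (e / L)); first by rewrite lt_min d0 divr_gt0.
move=> s s0; rewrite lt_min => /andP[sd sL].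
have [->|st] := eqVneq s t; first by rewrite subrr normr0 ltW.
have st0 : s - t != 0 by rewrite subr_eq0.
rewrite (_ : h s - h t = (h s - h t) / (s - t) * (s - t)); last by rewrite mulfVK.
rewrite normrM (@le_trans _ _ (L * (e / L)))//; last by rewrite mulrC divfK// gt_eqF.
apply: ler_pM => //; last exact: ltW.
rewrite /L -[X in `|X|](subrK (dRplus h t)) (le_trans (ler_normD _ _))// addrC lerD2l.
exact: hd.
Qed.

Lemma MVT_real (u du : R -> R) (a b : R) : (forall x : R, is_derive x (1 : R) u (du x)) ->
  exists2 c, `|c - a| <= `|b - a| & u b - u a = du c * (b - a).
Proof.
move=> hu.
have cu (i : interval R) : {within [set` i], continuous u}.
  by apply: derivable_within_continuous => x _; case: (hu x).
have [ab|ba] := leP a b.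
  have [c] := MVT_segment ab (fun x _ => hu x) (cu _).
  rewrite in_itv/= => /andP[ac cb] E; exists c => //.
  by rewrite !ger0_norm ?subr_ge0// lerD2r.
have [c] := MVT_segment (ltW ba) (fun x _ => hu x) (cu _).
rewrite in_itv/= => /andP[ac cb] E; exists c.
  by rewrite !ler0_norm; lra.
by rewrite -opprB E; ring.
Qed.

(** The mean value theorem wants a derivative only in the open interval, where [dRplus] is the
    two-sided one; at the endpoint 0 one-sided continuity is enough. *)
Lemma MVT_Rplus (h : R -> R) (a b : R) : (forall t, 0 <= t -> cvg (diff_quot_lim h t)) ->
  0 <= a -> 0 <= b ->
  exists c, [/\ 0 <= c, `|c - a| <= `|b - a| & h b - h a = dRplus h c * (b - a)].
Proof.
move=> ch.
have H (x y : R) : 0 <= x -> x <= y ->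
    exists c, [/\ x <= c, c <= y & h y - h x = dRplus h c * (y - x)].
  move=> x0 xy.
  have dh c : c \in `]x, y[ -> is_derive c (1 : R) h (dRplus h c).
    by rewrite in_itv/= => /andP[xc _]; apply: is_derive_dRplus; [lra|apply: ch; lra].
  have hc : {within `[x, y], continuous h}.
    apply/subspace_continuousP => s; rewrite /= in_itv/= => /andP[xs sy].
    have s0 : 0 <= s by lra.
    apply/cvgrPdist_le => e e0; have [d d0 hd] := dRplus_cont _ _ (ch _ s0) _ e0.
    apply/nbhs_ballP; exists d => //= r; rewrite -ball_normE /= distrC => rd.
    by rewrite in_itv/= => /andP[xr _]; rewrite distrC; apply: hd => //; lra.
  have [c] := MVT_segment xy dh hc.
  by rewrite in_itv/= => /andP[? ?]; exists c.
move=> a0 b0; have [ab|ba] := leP a b.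
  have [c [h1 h2 E]] := H _ _ a0 ab; exists c; split => //; first lra.
  by rewrite !ger0_norm ?subr_ge0// lerD2r.
have [c [h1 h2 E]] := H _ _ b0 (ltW ba); exists c; split; first lra.
  by rewrite !ler0_norm; lra.
by rewrite -opprB E; ring.
Qed.

Lemma is_derive_fst (g : plane R -> R) (x : plane R) : derivable g x (1, 0) ->
  is_derive x.1 1 (fun s => g (s, x.2)) (grad g x).1.
Proof.
case: x => x y dg.
have E : (fun k : R => k^-1 *: (g (k *: (1, 0) + (x, y)) - g (x, y))) =
         (fun k : R => k^-1 *: (g (k *: 1 + x, y) - g (x, y))).
  apply/funext => k; congr (_ *: (g _ - _)).
  by rewrite [LHS]surjective_pairing/= scaler0 add0r.
move: dg; rewrite /derivable E => dg; apply: DeriveDef; first exact dg.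
by rewrite /= /derive E.
Qed.

Lemma is_derive_snd (g : plane R -> R) (x : plane R) : derivable g x (0, 1) ->
  is_derive x.2 1 (fun s => g (x.1, s)) (grad g x).2.
Proof.
case: x => x y dg.
have E : (fun k : R => k^-1 *: (g (k *: (0, 1) + (x, y)) - g (x, y))) =
         (fun k : R => k^-1 *: (g (x, k *: 1 + y) - g (x, y))).
  apply/funext => k; congr (_ *: (g _ - _)).
  by rewrite [LHS]surjective_pairing/= scaler0 add0r.
move: dg; rewrite /derivable E => dg; apply: DeriveDef; first exact dg.
by rewrite /= /derive E.
Qed.

Lemma MVT_fst (g : plane R -> R) (a b y : R) : (forall x, derivable g x (1, 0)) ->
  exists2 c, `|c - a| <= `|b - a| & g (b, y) - g (a, y) = (grad g (c, y)).1 * (b - a).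
Proof.
move=> dg; apply: (@MVT_real (fun s => g (s, y)) (fun c => (grad g (c, y)).1)) => x.
exact: (is_derive_fst g (x, y)).
Qed.

Lemma MVT_snd (g : plane R -> R) (a b x : R) : (forall x, derivable g x (0, 1)) ->
  exists2 c, `|c - a| <= `|b - a| & g (x, b) - g (x, a) = (grad g (x, c)).2 * (b - a).
Proof.
move=> dg; apply: (@MVT_real (fun s => g (x, s)) (fun c => (grad g (x, c)).2)) => y.
exact: (is_derive_snd g (x, y)).
Qed.

Lemma continuous_RplusP (g : R -> plane R -> plane R -> R) : continuous_Rplus g ->
  forall (t : R) (z0 : phase R), 0 <= t -> forall e, 0 < e -> exists2 d, 0 < d &
  forall s (z : phase R), 0 <= s -> `|s - t| < d -> `|z - z0| < d ->
    `|g s z.1 z.2 - g t z0.1 z0.2| <= e.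
Proof.
move=> /subspace_continuousP cg t z0 t0 e e0.
have /cvgrPdist_le/(_ _ e0)/nbhs_ballP[d /= d0 hd] := cg (t, z0) (conj t0 I).
exists d => // s z s0 sd zd; rewrite distrC; apply: (hd (s, z)) => //.
by split; rewrite -ball_normE /= distrC.
Qed.
End Calculus.

Lemma compact_cball4 (R : realType) (z0 : phase R) (rho : R) :
  compact [set z : phase R | `|z0 - z| <= rho].
Proof.
rewrite (_ : mkset _ = ([set` `[z0.1.1 - rho, z0.1.1 + rho]] `*`
  [set` `[z0.1.2 - rho, z0.1.2 + rho]]) `*` ([set` `[z0.2.1 - rho, z0.2.1 + rho]] `*`
  [set` `[z0.2.2 - rho, z0.2.2 + rho]])).
  by do 2 ! apply: compact_setX; try apply: compact_setX; exact: segment_compact.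
transitivity (cball4 z0 rho : set (phase R)) => //.
by rewrite cball4E !cball2E !cball1E.
Qed.

(** * Maximum principle for transport by a bounded field *)

Section Transport.
Context {R : realType}.
Variable f : R -> plane R -> plane R -> R.
Hypothesis fC1 : C1_Rplus f.

Definition part_t (t : R) (z : phase R) : R := dRplus (fun s => f s z.1 z.2) t.
Definition part_x (t : R) (z : phase R) : plane R := grad (fun x' => f t x' z.2) z.1.
Definition part_v (t : R) (z : phase R) : plane R := grad (fun v' => f t z.1 v') z.2.

Lemma norm_phase_le (a b c d : R) (M : R) : `|a| <= M -> `|b| <= M -> `|c| <= M -> `|d| <= M ->
  `|((a, b), (c, d)) : phase R| <= M.
Proof. by move=> *; rewrite !prod_normE/= !ge_max; apply/andP; split; apply/andP. Qed.

Lemma norm_coord (z : phase R) :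
  [/\ `|z.1.1| <= `|z|, `|z.1.2| <= `|z|, `|z.2.1| <= `|z| & `|z.2.2| <= `|z|].
Proof. by split; rewrite !prod_normE/= !le_max lexx ?orbT. Qed.

(** Change one coordinate at a time, time first, and apply the one-dimensional mean value theorem to
    each. Every intermediate point lies in the box spanned by [z] and [z'], hence within [|z' - z|]
    of [z] in the max norm. *)
Lemma increment (t s : R) (z z' : phase R) : 0 <= t -> 0 <= s ->
  exists c p1 p2 q1 q2, [/\ (0 <= c /\ `|c - t| <= `|s - t|),
    (`|p1 - z| <= `|z' - z| /\ `|p2 - z| <= `|z' - z|),
    (`|q1 - z| <= `|z' - z| /\ `|q2 - z| <= `|z' - z|) &
    f s z'.1 z'.2 - f t z.1 z.2 = part_t c z' * (s - t) +
      ((part_x t p1).1 * (z' - z).1.1 + (part_x t p2).2 * (z' - z).1.2) +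
      ((part_v t q1).1 * (z' - z).2.1 + (part_v t q2).2 * (z' - z).2.2)].
Proof.
case: z => -[x1 x2] [v1 v2]; case: z' => -[y1 y2] [w1 w2] t0 s0 /=.
have [c [c0 cs Ec]] := MVT_Rplus (fun s => f s (y1, y2) (w1, w2)) t s
  (fun r => @C1_dt _ _ fC1 r _ _) t0 s0.
have [a1 ha1 E1] := MVT_fst (fun x => f t x (w1, w2)) x1 y1 y2
  (fun x => proj1 (@C1_dx _ _ fC1 t x _ t0)).
have [a2 ha2 E2] := MVT_snd (fun x => f t x (w1, w2)) x2 y2 x1
  (fun x => proj2 (@C1_dx _ _ fC1 t x _ t0)).
have [a3 ha3 E3] := MVT_fst (fun v => f t (x1, x2) v) v1 w1 w2
  (fun v => proj1 (@C1_dv _ _ fC1 t _ v t0)).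
have [a4 ha4 E4] := MVT_snd (fun v => f t (x1, x2) v) v2 w2 v1
  (fun v => proj2 (@C1_dv _ _ fC1 t _ v t0)).
have [/= n1 n2 n3 n4] := norm_coord (((y1, y2), (w1, w2)) - ((x1, x2), (v1, v2))).
have nn := normr_ge0 ((((y1, y2), (w1, w2)) : phase R) - ((x1, x2), (v1, v2))).
exists c, ((a1, y2), (w1, w2)), ((x1, a2), (w1, w2)), ((x1, x2), (a3, w2)), ((x1, x2), (v1,
  a4)).
split=> //.
- by split; apply: norm_phase_le => //=; rewrite ?subrr ?normr0//; apply: le_trans; eauto.
- by split; apply: norm_phase_le => //=; rewrite ?subrr ?normr0//; apply: le_trans; eauto.
rewrite /part_t /part_x /part_v /=.
transitivity ((f s (y1, y2) (w1, w2) - f t (y1, y2) (w1, w2)) +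
  ((f t (y1, y2) (w1, w2) - f t (x1, y2) (w1, w2)) + (f t (x1, y2) (w1, w2) - f t (x1, x2)
    (w1, w2))) +
  ((f t (x1, x2) (w1, w2) - f t (x1, x2) (v1, w2)) + (f t (x1, x2) (v1, w2) - f t (x1, x2)
    (v1, v2)))).
  by ring.
by rewrite Ec E1 E2 E3 E4.
Qed.

(** Continuous partial derivatives give differentiability, here up to the boundary [t = 0]. The
    factor 4 counts the coordinates of the phase space. *)
Lemma C1_differential (t : R) (z : phase R) : 0 <= t -> forall e, 0 < e ->
  exists2 d, 0 < d & forall s (z' : phase R), 0 <= s -> `|s - t| < d -> `|z' - z| < d ->
  `|f s z'.1 z'.2 - f t z.1 z.2 - (part_t t z * (s - t) + dot (part_x t z) (z' - z).1 +
     dot (part_v t z) (z' - z).2)| <= e * (`|s - t| + 4 * `|z' - z|).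
Proof.
move=> t0 e e0.
have [d0 d00 h0] := continuous_RplusP _ (C1_dt_cont fC1) _ z t0 _ e0.
have [d1 d10 h1] := continuous_RplusP _ (proj1 (C1_dx_cont fC1)) _ z t0 _ e0.
have [d2 d20 h2] := continuous_RplusP _ (proj2 (C1_dx_cont fC1)) _ z t0 _ e0.
have [d3 d30 h3] := continuous_RplusP _ (proj1 (C1_dv_cont fC1)) _ z t0 _ e0.
have [d4 d40 h4] := continuous_RplusP _ (proj2 (C1_dv_cont fC1)) _ z t0 _ e0.
exists (Num.min d0 (Num.min (Num.min d1 d2) (Num.min d3 d4))).
  by rewrite !lt_min d00 d10 d20 d30 d40.
move=> s z' s0; rewrite !lt_min => /and3P[s1 /andP[s2 s3] /andP[s4 s5]].
move=> /and3P[z1 /andP[z2 z3] /andP[z4 z5]].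
have [c [p1 [p2 [q1 [q2 [[c0 cs] [p1s p2s] [q1s q2s] ->]]]]]] := increment t s z z' t0 s0.
have [n1 n2 n3 n4] := norm_coord (z' - z).
have tt d : 0 < d -> `|t - t| < d by rewrite subrr normr0.
have {}h0 := h0 c z' c0 (le_lt_trans cs s1) z1.
have {}h1 := h1 t p1 t0 (tt _ d10) (le_lt_trans p1s z2).
have {}h2 := h2 t p2 t0 (tt _ d20) (le_lt_trans p2s z3).
have {}h3 := h3 t q1 t0 (tt _ d30) (le_lt_trans q1s z4).
have {}h4 := h4 t q2 t0 (tt _ d40) (le_lt_trans q2s z5).
have sumB (a0 a1 a2 a3 a4 b0 b1 b2 b3 b4 x0 x1 x2 x3 x4 : R) :
    a0 * x0 + (a1 * x1 + a2 * x2) + (a3 * x3 + a4 * x4) -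
    (b0 * x0 + (b1 * x1 + b2 * x2) + (b3 * x3 + b4 * x4)) =
    (a0 - b0) * x0 + ((a1 - b1) * x1 + (a2 - b2) * x2) +
    ((a3 - b3) * x3 + (a4 - b4) * x4) by ring.
rewrite /dot sumB.
have M (a b n : R) : `|a| <= e -> `|b| <= n -> `|a * b| <= e * n.
  by move=> ae bn; rewrite normrM ler_pM.
have := M _ _ _ h0 (lexx `|s - t|).
have := M _ _ _ h1 n1; have := M _ _ _ h2 n2.
have := M _ _ _ h3 n3; have := M _ _ _ h4 n4.
move=> k4 k3 k2 k1 k0.
apply: (le_trans (ler_normD _ _)); rewrite (_ : e * _ =
  (e * `|s - t| + (e * `|z' - z| + e * `|z' - z|)) + (e * `|z' - z| + e * `|z' - z|));
    last by ring.
apply: lerD; last by apply: (le_trans (ler_normD _ _)); exact: lerD.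
apply: (le_trans (ler_normD _ _)); apply: lerD => //.
by apply: (le_trans (ler_normD _ _)); exact: lerD.
Qed.

Variables (b : R -> phase R -> phase R) (T Bd : R).
Hypothesis bB : forall t z, 0 <= t <= T -> `|b t z| <= Bd.
Hypothesis transport : forall t z, 0 <= t <= T ->
  part_t t z + dot (b t z).1 (part_x t z) + dot (b t z).2 (part_v t z) = 0.

(* A maximum of [sg * f - eps * t] over the truncated cone cannot have
   positive time: going backwards along the direction [(-1, - b)] stays in the
   cone, and the derivative of [f] in that direction vanishes. *)
Lemma cone_le0 (sg : R) (z0 : phase R) (rho : R) : `|sg| = 1 -> 0 <= Bd ->
  (forall z : phase R, `|z - z0| <= rho -> f 0 z.1 z.2 = 0) ->
  forall t (z : phase R), 0 <= t <= T -> `|z - z0| + Bd * t <= rho -> sg * f t z.1 z.2 <= 0.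
Proof.
move=> sg1 Bd0 f0 t z tT zt.
pose K : set (R * phase R) :=
  [set p | 0 <= p.1 <= T /\ `|p.2 - z0| + Bd * p.1 <= rho].
have K0 : K !=set0 by exists (t, z).
have cK : compact K.
  pose q (p : R * phase R) := `|p.2 - z0| + Bd * p.1.
  apply: (@subclosed_compact _ K ([set` `[0, T]] `*` [set z : phase R | `|z0 - z| <= rho])).
  - rewrite (_ : K = fst @^-1` [set` `[0, T]] `&` q @^-1` [set` `]-oo, rho]]); last first.
      by apply/predeqP => p; rewrite /K /q /= !in_itv/=.
    apply: closedI; apply: closed_comp => [p _|]; do ?exact: itv_closed.
    + exact: cvg_fst.
    + apply: (@lipschitz_continuous _ _ _ (1 + Bd)) => a c.
      have h1 : `|a.1 - c.1| <= `|a - c| by rewrite prod_normE le_max lexx.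
      have h2 : `|a.2 - c.2| <= `|a - c| by rewrite prod_normE le_max lexx orbT.
      rewrite /q [X in `|X|](_ : _ = (`|a.2 - z0| - `|c.2 - z0|) + Bd * (a.1 - c.1));
        last by ring.
      rewrite (le_trans (ler_normD _ _))// mulrDl mul1r lerD//.
        rewrite (le_trans (ler_dist_dist _ _))// opprB addrA subrK//.
      by rewrite normrM ger0_norm// ler_wpM2l.
    + by rewrite set_itvE; exact: closed_le.
  - have := compact_setX (@segment_compact R 0 T) (compact_cball4 R z0 rho); exact.
  - move=> p [p1 p2]; split => /=; first by rewrite in_itv.
    by rewrite distrC; apply: le_trans p2; rewrite lerDl mulr_ge0//; case/andP: p1.
rewrite -lee_fin; apply/lee_addgt0Pr => /= e0 e00.
rewrite add0e lee_fin.
(* The penalty [- e * t] excludes a maximum at positive time and costs at most [e0] up to time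
   [T]. *)
have [e e_gt0 eT] : exists2 e, 0 < e & e * T <= e0.
  exists (e0 / (`|T| + 1)); first by rewrite divr_gt0// ltr_wpDl.
  rewrite mulrAC ler_pdivrMr ?ltr_wpDl// ler_pM2l// (le_trans (ler_norm T))//.
  by rewrite lerDl.
pose g (p : R * phase R) := sg * f p.1 p.2.1 p.2.2 - e * p.1.
have cg : {within K, continuous g}.
  apply/subspace_continuousP => p Kp; apply: cvgB; last first.
    by apply: cvgM; [exact: cvg_cst|exact: cvg_within_filter cvg_fst].
  apply: cvgM; first exact: cvg_cst.
  have /subspace_continuousP : {within K, continuous (fun p : R * phase R => f p.1 p.2.1
    p.2.2)}.
    apply: continuous_subspaceW (C1_cont fC1) => a [/= aT _]; split => //=.
    by case/andP: aT.
  exact.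
have [[t1 z1]] := compact_EVT_max K0 cK cg.
rewrite inE => -[/= t1T z1t] gmax.
have [t10|t10] := eqVneq t1 0.
  have := gmax (t, z); rewrite inE => /(_ (conj tT zt)); rewrite /g /=.
  rewrite t10 f0 ?mulr0 ?subr0; last by move: z1t; rewrite t10 mulr0 addr0.
  rewrite subr_le0 => /le_trans; apply; apply: le_trans eT.
  by rewrite ler_pM2l//; case/andP: tT.
have {}t10 : 0 < t1 by rewrite lt_neqAle eq_sym t10; case/andP: t1T.
have q0 : 0 < 1 + 4 * Bd by rewrite ltr_pwDl// mulr_ge0.
(* This precision keeps the change of [f] over a backward step of length [h] below [e * h / 2],
   whereas maximality forces [sg * f] to drop by at least [e * h]. *)
have [d d0 hd] := C1_differential t1 z1 (ltW t10) (e / (2 * (1 + 4 * Bd)))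
  (divr_gt0 e_gt0 (mulr_gt0 (ltr0Sn R 1) q0)).
have [h [h0 ht hd1 hd2]] : exists h, [/\ 0 < h, h <= t1, h < d & h * Bd < d].
  have q1 : 0 < 1 + Bd by rewrite ltr_pwDl.
  exists (Num.min t1 (d / (2 * (1 + Bd)))).
  have m0 : 0 < d / (2 * (1 + Bd)) by rewrite divr_gt0// mulr_gt0.
  have m1 : d / (2 * (1 + Bd)) * (1 + Bd) < d.
    rewrite (_ : _ * _ = d / 2); last by field; rewrite gt_eqF.
    by rewrite ltr_pdivrMr// ltr_pMr// ltr1n.
  split.
  - by rewrite lt_min t10.
  - by rewrite ge_min lexx.
  - rewrite gt_min; apply/orP; right; apply: le_lt_trans m1.
    by apply: ler_peMr; [exact: ltW|rewrite lerDl].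
  - apply: le_lt_trans m1; apply: ler_pM => //.
    + by rewrite le_min !ltW.
    + by rewrite ge_min lexx orbT.
    + by rewrite lerDr.
pose z2 : phase R := z1 - h *: b t1 z1.
have bz := bB _ z1 t1T.
have zz : z2 - z1 = - (h *: b t1 z1) by rewrite /z2 addrAC subrr add0r.
have nz : `|z2 - z1| <= h * Bd.
  by rewrite zz normrN normrZ gtr0_norm// ler_pM2l.
(* Going back by [h] widens the section of the cone by [Bd * h], which absorbs the displacement. *)
have K2 : K (t1 - h, z2).
  split => /=; first by move: t1T; lra.
  apply: le_trans z1t; rewrite (_ : z2 - z0 = (z1 - z0) + (z2 - z1));
    last by rewrite [RHS]addrC addrA subrK.
  have := ler_normD (z1 - z0) (z2 - z1); lra.
clearbody z2.
have := gmax (t1 - h, z2); rewrite inE => /(_ K2); rewrite /g /= => G.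
have := hd (t1 - h) z2.
rewrite (_ : t1 - h - t1 = - h); last by ring.
rewrite normrN (gtr0_norm h0) => /(_ _ hd1 (le_lt_trans nz hd2)).
rewrite subr_ge0 => /(_ ht).
have dotN (w w' : plane R) : dot w' (- (h *: w)) = - h * dot w w'.
  rewrite /dot /=; have sc (r : R) : h *: r = h * r by [].
  by rewrite !sc; ring.
have -> : part_t t1 z1 * - h + dot (part_x t1 z1) (z2 - z1).1 +
    dot (part_v t1 z1) (z2 - z1).2 =
    - h * (part_t t1 z1 + dot (b t1 z1).1 (part_x t1 z1) + dot (b t1 z1).2 (part_v t1 z1)).
  by rewrite zz dotN dotN [part_t t1 z1 * _]mulrC -!mulrDr.
rewrite (transport _ _ t1T) mulr0 subr0 => D.
have : `|f (t1 - h) z2.1 z2.2 - f t1 z1.1 z1.2| <= e * h / 2.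
  apply: (le_trans D).
  apply: (@le_trans _ _ (e / (2 * (1 + 4 * Bd)) * (h + 4 * (h * Bd)))).
    rewrite ler_pM2l ?divr_gt0 ?mulr_gt0// lerD2l ler_pM2l//.
  rewrite le_eqVlt; apply/orP; left; apply/eqP; field.
  by rewrite gt_eqF.
rewrite -[leLHS]mul1r -{1}sg1 -normrM mulrBr ler_norml => /andP[Dl _].
have : 0 < e * h by rewrite mulr_gt0.
lra.
Qed.

(** The cone of vertex [(t, z)] has a base of radius [Bd * t] around [z], which misses the initial
    support; the two signs of [sg] together give 0. *)
Lemma support_propagation (rho : R) : 0 <= Bd ->
  (forall z : phase R, rho < `|z| -> f 0 z.1 z.2 = 0) ->
  forall t (z : phase R), 0 <= t <= T -> rho + Bd * T < `|z| -> f t z.1 z.2 = 0.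
Proof.
move=> Bd0 f0 t z tT zT.
have H sg : `|sg| = 1 -> sg * f t z.1 z.2 <= 0.
  move=> sg1; apply: (cone_le0 sg z (Bd * t) sg1 Bd0) => //; last by rewrite subrr normr0 add0r.
  move=> y yz; apply: f0; have := ler_normD (z - y) y; rewrite subrK distrC => zy.
  have : Bd * t <= Bd * T by rewrite ler_wpM2l//; case/andP: tT.
  lra.
by apply/eqP; rewrite eq_le; have := H 1 (normr1 _); have := H (-1) (normrN1 _); lra.
Qed.
End Transport.

(** * Differentiation of the potential *)

Section Analysis.
Context {R : realType}.

(** This opens the way to dominated convergence. The sequences may be taken within distance 1 of
    [t], so that a single dominating function can serve all their terms. *)
Lemma limit_by_sequences (Q : R -> R) (S : set R) (t l : R) :
  (forall u : nat -> R, (forall n, [/\ S (u n), u n != t & `|u n - t| <= 1]) -> u @ \oo --> t ->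
    Q (u n) @[n --> \oo] --> l) ->
  forall e, 0 < e -> exists2 d, 0 < d & forall s, S s -> s != t -> `|s - t| < d ->
    `|Q s - l| <= e.
Proof.
move=> H e e0; apply: contrapT => /forall2NP N.
have {}N n : exists s, [/\ S s, s != t, `|s - t| < n.+1%:R^-1 & e < `|Q s - l|].
  have [|/existsNP[s]] := N n.+1%:R^-1; first by rewrite invr_gt0.
  move=> /not_implyP[Ss /not_implyP[st /not_implyP[sn /negP]]].
  by rewrite -ltNge => es; exists s.
have [u uP] := choice N.
have ut : u @ \oo --> t.
  apply/cvgrPdist_lt => d d0.
  near=> n; rewrite distrC; have [_ _ + _] := uP n; move/lt_trans; apply.
  by near: n; exact: near_infty_natSinv_lt (PosNum d0).
have /cvgrPdist_lt/(_ _ e0)[n _ /(_ n (leqnn n))] : Q (u n) @[n --> \oo] --> l.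
  apply: H => // m; have [? ? um _] := uP m; split => //.
  by apply: (le_trans (ltW um)); rewrite invf_le1// ler1n.
rewrite distrC /=; have [_ _ _ h] := uP n; move/(lt_trans h).
by rewrite ltxx.
Unshelve. all: by end_near. Qed.

Lemma derivable_of_line (V : normedModType R) (h : V -> R) (z e : V) (l : R) :
  is_derive (0 : R) (1 : R) (fun s : R => h (s *: e + z)) l -> derivable h z e.
Proof.
have E : (fun s : R => s^-1 *: (h (s *: e + z) - h z)) =
    (fun s : R => s^-1 *: (h ((s * 1 + 0) *: e + z) - h (0 *: e + z))).
  by apply/funext => s; rewrite scale0r add0r addr0 mulr1.
by move=> [+ _]; rewrite /derivable /= E.
Qed.

Lemma integrable_cst_cball (M r : R) : 0 <= r ->
  mu4.-integrable setT (EFin \o (fun z => M * \1_(cball4 (0 : phase R) r) z)).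
Proof.
move=> r0; apply/integrableP; split.
  apply/measurable_EFinP; apply: measurable_funM => //.
  by apply: measurable_indic; exact: measurable_cball4.
rewrite (eq_integral (fun z => (`|M|%:E * (\1_(cball4 (0 : phase R) r) z)%:E)%E)); last first.
  by move=> z _ /=; rewrite normrM -EFinM; congr ((_ * _)%:E); rewrite ger0_norm.
rewrite ge0_integralZl_EFin//.
  rewrite integral_indic//; last exact: measurable_cball4.
  by rewrite setIT [X in (_ * X)%E]mu4_cball// -EFinM ltry.
by apply/measurable_EFinP; apply: measurable_indic; exact: measurable_cball4.
Qed.

Lemma indic_cball0 (r : R) (z : phase R) : r < `|z| -> \1_(cball4 (0 : phase R) r) z = 0 :> R.
Proof.
by move=> zr; rewrite indicE memNset// /cball4/= sub0r normrN; apply/negP; rewrite -ltNge.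
Qed.

Lemma indic_cball1 (r : R) (z : phase R) : `|z| <= r -> \1_(cball4 (0 : phase R) r) z = 1 :> R.
Proof. by move=> zr; rewrite indicE mem_set// /cball4/= sub0r normrN. Qed.

Lemma integrable_bounded_support (h : phase R -> R) (M r : R) :
  measurable_fun [set: T4 R] h -> (forall z, `|h z| <= M) ->
  (forall z : phase R, r < `|z| -> h z = 0) -> 0 <= r ->
  mu4.-integrable setT (EFin \o h).
Proof.
move=> mh hM h0 r0.
apply: (le_integrable measurableT _ _ (integrable_cst_cball M r r0)).
  exact/measurable_EFinP.
move=> z _ /=; rewrite lee_fin; have [zr|zr] := leP `|z| r.
  by rewrite indic_cball1// mulr1 (le_trans (hM z))// ler_norm.
by rewrite indic_cball0// mulr0 normr0 h0// normr0.
Qed.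

Lemma dominated_cvg4 (u : nat -> phase R -> R) (v w : phase R -> R) :
  (forall n, measurable_fun [set: T4 R] (u n)) ->
  (forall z, u n z @[n --> \oo] --> v z) ->
  mu4.-integrable setT (EFin \o w) -> (forall n z, `|u n z| <= w z) ->
  mu4.-integrable setT (EFin \o v) /\ \int[mu4]_z u n z @[n --> \oo] --> \int[mu4]_z v z.
Proof.
move=> mu_ uv iw uw.
have mv : measurable_fun [set: T4 R] v.
  by apply: (@measurable_fun_cvg _ _ _ _ u) => // z _; exact: uv.
have [|||||iv _ cv] := @dominated_convergence _ (T4 R) R mu4 setT measurableT
  (fun n => EFin \o u n) (EFin \o v) (EFin \o w).
- by move=> n; apply/measurable_EFinP; exact: mu_.
- exact/measurable_EFinP.
- by apply: aeW => z _; apply: cvg_EFin; [exact: nearW|exact: uv].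
- exact: iw.
- by apply: aeW => z n _; rewrite lee_fin; exact: uw.
split => //; apply: fine_cvg.
by rewrite fineK//; exact: integrable_fin_num.
Qed.
End Analysis.

Record lip_bounded_support (R : realType) (g : phase R -> R) (M L r : R) : Prop := {
  lbs_L : 0 <= L;
  lbs_r : 0 <= r;
  lbs_bound : forall z, `|g z| <= M;
  lbs_lip : forall a b, `|g a - g b| <= L * `|a - b|;
  lbs_supp : forall z : phase R, r < `|z| -> g z = 0
}.
Arguments lip_bounded_support {R} g M L r.
Arguments lbs_L {R g M L r}.
Arguments lbs_r {R g M L r}.
Arguments lbs_bound {R g M L r}.
Arguments lbs_lip {R g M L r}.
Arguments lbs_supp {R g M L r}.

(** * Directional derivatives of the potential *)

Section ConvDerivable.
Context {R : realType}.
Variables (k : phase R -> R) (C : R).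
Hypothesis kC : log_singular k C.

Let C0 := log_singular_ge0 kC.

Lemma lbs_measurable (g : phase R -> R) M L r : lip_bounded_support g M L r ->
  measurable_fun [set: T4 R] g.
Proof.
by move=> hg; apply: continuous_measurable4; exact: lipschitz_continuous (lbs_lip hg).
Qed.

(** A bound for the integral of [|k (z - y)|] over [|y| <= r]: there [|z - y| <= |z| + r], the
    volume is [(2 * r) ^ 4], and [64 + (2 * r) ^ 4] is [integral_inv_dist_le] for an indicator
    function. *)
Definition ker_mass (z : phase R) (r : R) : R :=
  C * ((`|z| + r) * (2 * r) ^+ 4 + (64 + (2 * r) ^+ 4)).

Lemma measurable_ker_cball z r :
  measurable_fun [set: T4 R] (fun y => `|k (z - y)| * \1_(cball4 0 r) y).
Proof.
apply: measurable_funM; first by apply: measurableT_comp => //;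
  exact: measurable_ker_shift kC z.
by apply: measurable_indic; exact: measurable_cball4.
Qed.

Lemma ker_mass_le z r : 0 <= r ->
  (\int[mu4]_y (`|k (z - y)| * \1_(cball4 0 r) y)%:E <= (ker_mass z r)%:E)%E.
Proof.
move=> r0.
have mi : measurable_fun [set: T4 R] (fun y => \1_(cball4 0 r) y : R).
  by apply: measurable_indic; exact: measurable_cball4.
have int1 : (\int[mu4]_y (\1_(cball4 (0 : phase R) r) y)%:E = ((2 * r) ^+ 4)%:E)%E.
  rewrite integral_indic//; last exact: measurable_cball4.
  by rewrite setIT; exact: mu4_cball.
have intz : (\int[mu4]_y (`|z - y|^-1 * `|\1_(cball4 (0 : phase R) r)
  y : R|)%:E <= (64 * 1 + (2 * r) ^+ 4)%:E)%E.
  apply: integral_inv_dist_le => //.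
    by move=> y; rewrite indicE; case: (_ \in _); rewrite ?normr1 ?normr0.
  rewrite -int1; apply: ge0_le_integral => //.
  - by apply/measurable_EFinP; exact: measurableT_comp.
  - exact/measurable_EFinP.
  - by move=> y _; rewrite lee_fin ger0_norm.
apply: (@le_trans _ _ (\int[mu4]_y (C%:E * ((`|z| + r)%:E * (\1_(cball4 (0 : phase R) r) y)%:E +
   (`|z - y|^-1 * `|\1_(cball4 (0 : phase R) r) y : R|)%:E))%E)%E).
  apply: ge0_le_integral => //.
  - by apply/measurable_EFinP; exact: measurable_ker_cball.
  - apply/measurable_EFinP; apply: measurable_funM => //; apply: measurable_funD.
      exact: measurable_funM.
    apply: measurable_funM; first exact: measurable_inv_dist4.
    exact: measurableT_comp.
  - move=> y _; rewrite -EFinM lee_fin indicE.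
    have [yr|_] := boolP (y \in cball4 0 r); last by rewrite !mulr0 normr0 mulr0 addr0 mulr0.
    rewrite normr1 !mulr1; apply: (le_trans (log_singular_bound kC _)).
    rewrite ler_wpM2l// lerD2r (le_trans (ler_normB _ _))// lerD2l.
    by move: yr; rewrite inE /cball4/= sub0r normrN.
have zr0 : 0 <= `|z| + r by rewrite addr_ge0.
have mI : measurable_fun [set: T4 R] (fun y => `|z - y|^-1 * `|\1_(cball4 (0 : phase R) r)
  y : R|).
  apply: measurable_funM; first exact: measurable_inv_dist4.
  exact: measurableT_comp.
rewrite ge0_integralZl_EFin//; last 2 first.
- by move=> y _; rewrite -EFinM -EFinD lee_fin addr_ge0 ?mulr_ge0.
- by apply/measurable_EFinP; apply: measurable_funD => //; exact: measurable_funM.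
rewrite /ker_mass EFinM lee_wpmul2l ?lee_fin// [X in (_ <= X)%E]EFinD.
rewrite ge0_integralD//; last 3 first.
- by move=> y _; rewrite -EFinM lee_fin mulr_ge0.
- by apply/measurable_EFinP; exact: measurable_funM.
- exact/measurable_EFinP.
rewrite ge0_integralZl_EFin//; last exact/measurable_EFinP.
rewrite int1; apply: leeD; first by rewrite [in leRHS]EFinM.
by move: intz; rewrite mulr1.
Qed.

Lemma integrable_ker_cball z r : 0 <= r ->
  mu4.-integrable setT (EFin \o (fun y => `|k (z - y)| * \1_(cball4 0 r) y)).
Proof.
move=> r0; apply/integrableP; split; first by apply/measurable_EFinP;
  exact: measurable_ker_cball.
apply: (@le_lt_trans _ _ (ker_mass z r)%:E); last exact: ltry.
apply: (le_trans _ (ker_mass_le z r r0)); rewrite le_eqVlt; apply/orP; left; apply/eqP.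
by apply: eq_integral => y _; rewrite /= normrM normr_id [X in _ * X]ger0_norm.
Qed.

Lemma measurable_ker_mul z (g : phase R -> R) : measurable_fun [set: T4 R] g ->
  measurable_fun [set: T4 R] (fun y => k (z - y) * g y).
Proof. by move=> mg; apply: measurable_funM => //; exact: measurable_ker_shift kC z. Qed.

Lemma ker_mul_le z (g : phase R -> R) M r : (forall y, `|g y| <= M) ->
  (forall y : phase R, r < `|y| -> g y = 0) ->
  forall y, `|k (z - y) * g y| <= M * (`|k (z - y)| * \1_(cball4 0 r) y).
Proof.
move=> gM g0 y; have [yr|yr] := leP `|y| r.
  by rewrite indic_cball1// mulr1 normrM mulrC ler_wpM2r.
by rewrite g0// indic_cball0// !mulr0 normr0.
Qed.

Lemma integrable_ker_dom z M r : 0 <= r ->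
  mu4.-integrable setT (EFin \o (fun y => M * (`|k (z - y)| * \1_(cball4 0 r) y))).
Proof.
move=> r0; rewrite (_ : _ \o _ = (fun y => M%:E * (`|k (z - y)| * \1_(cball4 0 r) y)%:E)%E)//.
by apply: integrableZl => //; exact: integrable_ker_cball.
Qed.

Lemma integrable_ker_mul z (g : phase R -> R) M r : 0 <= r ->
  measurable_fun [set: T4 R] g -> (forall y, `|g y| <= M) ->
  (forall y : phase R, r < `|y| -> g y = 0) ->
  mu4.-integrable setT (EFin \o (fun y => k (z - y) * g y)).
Proof.
move=> r0 mg gM g0.
apply: (le_integrable measurableT _ _ (integrable_ker_dom z M r r0)).
  by apply/measurable_EFinP; exact: measurable_ker_mul.
move=> y _ /=; rewrite lee_fin (le_trans (ker_mul_le z g M r gM g0 y))//.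
exact: ler_norm.
Qed.

Lemma conv_bound z (g : phase R -> R) M r : 0 <= r ->
  measurable_fun [set: T4 R] g -> (forall y, `|g y| <= M) ->
  (forall y : phase R, r < `|y| -> g y = 0) -> `|conv k g z| <= M * ker_mass z r.
Proof.
move=> r0 mg gM g0; have M0 : 0 <= M by exact: le_trans (gM 0).
have ig := integrable_ker_mul z g M r r0 mg gM g0.
rewrite /conv -lee_fin EFin_normr_Rintegral//.
apply: (le_trans (le_abse_integral _ _ _)) => //; first exact: measurable_int ig.
apply: (@le_trans _ _ (\int[mu4]_y (M%:E * (`|k (z - y)| * \1_(cball4 0 r) y)%:E)%E)%E).
  apply: ge0_le_integral => //.
  - by apply: measurableT_comp => //; exact: measurable_int ig.
  - by apply/measurable_EFinP; apply: measurable_funM => //; exact: measurable_ker_cball.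
  - by move=> y _; rewrite /= -EFinM lee_fin; exact: ker_mul_le.
rewrite ge0_integralZl_EFin//.
- by rewrite [leRHS]EFinM lee_wpmul2l ?lee_fin//; exact: ker_mass_le.
- by apply/measurable_EFinP; exact: measurable_ker_cball.
Qed.

Lemma conv_shift z a (g : phase R -> R) M r : 0 <= r ->
  measurable_fun [set: T4 R] g -> (forall y, `|g y| <= M) ->
  (forall y : phase R, r < `|y| -> g y = 0) ->
  conv k g (z + a) = \int[mu4]_y (k (z - y) * g (y + a)).
Proof.
move=> r0 mg gM g0; have ig := integrable_ker_mul (z + a) g M r r0 mg gM g0.
rewrite /conv -(Rintegral_shift4 _ a ig); apply: eq_Rintegral => y _ /=.
by congr (k _ * _); rewrite opprD addrACA subrr addr0.
Qed.

(* [k] is not differentiable; a translation of the integration variable moves the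
   difference quotient onto [g]. *)
Lemma conv_derivable (g : phase R -> R) M L r (e : phase R) :
  lip_bounded_support g M L r -> (forall z, derivable g z e) ->
  forall z, derivable (conv k g) z e.
Proof.
move=> hg dg z; have mg := lbs_measurable _ _ _ _ hg.
have [L0 r0 gM gL g0] := hg.
apply: (@derivable_of_line _ _ _ _ _ (\int[mu4]_y (k (z - y) * 'D_e g y))).
apply: is_derive_eps.
have := @limit_by_sequences R (fun s => (conv k g (s *: e + z) - conv k g (0 *: e + z))
  / (s - 0))
  setT 0 (\int[mu4]_y (k (z - y) * 'D_e g y)).
move=> H; suff K : forall u : nat -> R, (forall n, [/\ setT (u n), u n != 0 & `|u n - 0| <=
  1]) ->
    u @ \oo --> (0 : R) ->
    (conv k g (u n *: e + z) - conv k g (0 *: e + z)) / (u n - 0) @[n --> \oo] -->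
      \int[mu4]_y (k (z - y) * 'D_e g y).
  by move=> d d0; have [c c0 hc] := H K d d0; exists c => // s; exact: hc.
move=> u uP u0.
have r1 : 0 <= r + `|e| by rewrite addr_ge0.
(* As [|u n| <= 1], these quotients are bounded by [L * |e|] and vanish outside the ball of radius
   [r + |e|], uniformly in [n]. *)
pose D n y := (g (y + u n *: e) - g y) / u n.
have mD n : measurable_fun [set: T4 R] (D n).
  apply: measurable_funM => //; apply: measurable_funB => //.
  exact: (measurableT_comp mg (measurable_shift4 _)).
have DL n y : `|D n y| <= L * `|e|.
  have [_ un0 _] := uP n; rewrite /D normrM normfV ler_pdivrMr ?normr_gt0//.
  by rewrite (le_trans (gL _ _))// addrAC subrr add0r normrZ mulrAC mulrA.
have D0 n (y : phase R) : r + `|e| < `|y| -> D n y = 0.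
  move=> ry; have [_ _] := uP n; rewrite subr0 => un1.
  rewrite /D !g0 ?subrr ?mul0r//; first by apply: le_lt_trans ry; rewrite lerDl.
  have h1 : `|u n *: e| <= `|e| by rewrite normrZ ler_piMl.
  have := ler_normB (y + u n *: e) (u n *: e); rewrite addrK; lra.
have [] := dominated_cvg4 (fun n y => k (z - y) * D n y) (fun y => k (z - y) * 'D_e g y)
   (fun y => (L * `|e|) * (`|k (z - y)| * \1_(cball4 0 (r + `|e|)) y)).
- by move=> n; exact: measurable_ker_mul.
- move=> y; apply: cvgM; first exact: cvg_cst.
  have /cvgrPdist_le dgy := dg y.
  apply/cvgrPdist_le => d d0; have /nbhs_ballP[c /= c0 hc] := dgy _ d0.
  have /cvgrPdist_lt/(_ _ c0) uc := u0.
  near=> n; have [_ un0 _] := uP n.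
  have := hc (u n); rewrite -ball_normE /= /D [y + _]addrC mulrC; apply => //.
  by near: n.
- exact: integrable_ker_dom.
- by move=> n y; apply: ker_mul_le; [exact: DL|exact: D0].
move=> _; apply: cvg_trans; apply: near_eq_cvg; apply: nearW => n.
have igu : mu4.-integrable setT (EFin \o (fun y => k (z - y) * g (y + u n *: e))).
  apply: (@integrable_ker_mul _ _ M (r + `|u n *: e|)) => //.
  - by rewrite addr_ge0.
  - exact: (measurableT_comp mg (measurable_shift4 _)).
  - move=> y ry; apply: g0.
    by have := ler_normB (y + u n *: e) (u n *: e); rewrite addrK; lra.
have ig := integrable_ker_mul z g M r r0 mg gM g0.
rewrite scale0r add0r (addrC _ z) (conv_shift _ _ g M r)// subr0 /conv -RintegralB//.
have [_ un0 _] := uP n.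
rewrite -RintegralZr//.
  by apply: eq_Rintegral => y _; rewrite /D; ring.
rewrite (_ : _ \o _ = (fun y => (k (z - y) * g (y + u n *: e))%:E -
   (k (z - y) * g y)%:E)%E)//.
exact: integrableB.
Unshelve. all: by end_near. Qed.
End ConvDerivable.

(** * Integral of a Jacobian *)

Section Jacobian.
Context {R : realType}.

Lemma integrable_RintegralB (u v : phase R -> R) :
  mu4.-integrable setT (EFin \o u) -> mu4.-integrable setT (EFin \o v) ->
  mu4.-integrable setT (EFin \o (fun z => u z - v z)) /\
  \int[mu4]_z (u z - v z) = \int[mu4]_z u z - \int[mu4]_z v z.
Proof.
move=> iu iv; split; last by rewrite RintegralB.
rewrite (_ : _ \o _ = (fun y => (u y)%:E - (v y)%:E)%E)//; exact: integrableB.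
Qed.

(** A central quotient is the mean of the quotients with steps [x] and [- x]. *)
Lemma central_quotient_cvg (V : normedModType R) (g : V -> R) (z e : V) : derivable g z e ->
  (g (z + n.+1%:R^-1 *: e) - g (z - n.+1%:R^-1 *: e)) / (2 * n.+1%:R^-1)
    @[n --> \oo] --> 'D_e g z.
Proof.
move=> /cvgrPdist_le dg; apply/cvgrPdist_le => d d0.
have /nbhs_ballP[c /= c0 hc] := dg _ d0.
near=> n.
have n0 : 0 < n.+1%:R^-1 :> R by rewrite invr_gt0.
have nc : n.+1%:R^-1 < c by near: n; exact: near_infty_natSinv_lt (PosNum c0).
have h1 := hc (n.+1%:R^-1); rewrite -ball_normE /= sub0r normrN gtr0_norm// in h1.
have {}h1 := h1 nc (lt0r_neq0 n0).
have h2 := hc (- n.+1%:R^-1); rewrite -ball_normE /= sub0r opprK gtr0_norm// in h2.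
rewrite oppr_eq0 in h2; have {}h2 := h2 nc (lt0r_neq0 n0).
rewrite scaleNr in h2.
move: h1 h2; rewrite ![_ + z]addrC; rewrite -/('D_e g z).
set x := n.+1%:R^-1 in n0 *.
set p := g (z + _); set q := g (z - _).
have sc (a b : R) : a *: b = a * b by [].
rewrite !sc => h1 h2.
rewrite (_ : 'D_e g z - (p - q) / (2 * x) =
  (('D_e g z - x^-1 * (p - g z)) + ('D_e g z - (- x)^-1 * (q - g z))) / 2); last first.
  by field; rewrite gt_eqF.
rewrite normrM [`|2^-1|]gtr0_norm ?invr_gt0// ler_pdivrMr//.
by rewrite (le_trans (ler_normD _ _))// mulr_natr mulr2n lerD.
Unshelve. all: by end_near. Qed.

(** Integrability is included because [Rintegral] may be 0 by convention, and because the sums below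
    need it. *)
Definition Znull (u : phase R -> R) : Prop :=
  mu4.-integrable setT (EFin \o u) /\ \int[mu4]_z u z = 0.

Lemma ZnullB (u v : phase R -> R) : Znull u -> Znull v -> Znull (fun z => u z - v z).
Proof.
move=> [iu u0] [iv v0]; have [iuv E] := integrable_RintegralB _ _ iu iv.
by split => //; rewrite E u0 v0 subr0.
Qed.

Lemma ZnullZ (u : phase R -> R) (c : R) : Znull u -> Znull (fun z => c * u z).
Proof.
move=> [iu u0]; split; last by rewrite RintegralZl// u0 mulr0.
rewrite (_ : _ \o _ = (fun y => c%:E * (u y)%:E)%E)//.
exact: integrableZl.
Qed.

Variables (F G : phase R -> R) (M L r M' L' : R) (e1 e2 : phase R).
Hypothesis hF : lip_bounded_support F M L r.
Hypothesis (e1_le1 : `|e1| <= 1) (e2_le1 : `|e2| <= 1).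
Hypothesis mG : measurable_fun [set: T4 R] G.
Hypothesis GM : forall z : phase R, `|z| <= r + 2 -> `|G z| <= M'.
Hypothesis L'0 : 0 <= L'.
Hypothesis GL : forall a b : phase R, `|a| <= r + 2 -> `|b| <= r + 2 ->
  `|G a - G b| <= L' * `|a - b|.
Hypothesis dF : forall z, derivable F z e1 /\ derivable F z e2.
Hypothesis dG : forall z, derivable G z e1 /\ derivable G z e2.

Let r0 := lbs_r hF.
Let mF := lbs_measurable _ _ _ _ hF.

Let M'0 : 0 <= M'.
Proof. by apply: (le_trans _ (GM 0 _)); rewrite ?normr0 ?addr_ge0. Qed.

Lemma normD_le (z e : phase R) (a : R) : `|a| <= 1 -> `|e| <= 1 -> `|z + a *: e| <= `|z| + 1.
Proof.
move=> a1 ee; rewrite (le_trans (ler_normD _ _))// lerD2l normrZ.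
by rewrite -[leRHS]mulr1 ler_pM.
Qed.

Lemma normD_ge (z e : phase R) (a : R) : `|a| <= 1 -> `|e| <= 1 -> `|z| - 1 <= `|z + a *: e|.
Proof.
move=> a1 ee; have := normD_le (z + a *: e) e (- a).
by rewrite normrN scaleNr addrK lerBlDr; exact.
Qed.

Lemma integrable_FG (a b : R) (e e' : phase R) :
  `|a| <= 1 -> `|b| <= 1 -> `|e| <= 1 -> `|e'| <= 1 ->
  mu4.-integrable setT (EFin \o (fun z => F (z + a *: e) * G (z + b *: e'))).
Proof.
move=> a1 b1 ee ee'; apply: (@integrable_bounded_support _ _ (M * M') (r + 1)).
- by apply: measurable_funM; [exact: (measurableT_comp mF (measurable_shift4 _))|
    exact: (measurableT_comp mG (measurable_shift4 _))].
- move=> z; have [zr|zr] := leP `|z| (r + 1).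
    rewrite normrM ler_pM//; first exact: (lbs_bound hF).
    by apply: GM; have := normD_le z e' b b1 ee'; lra.
  rewrite (lbs_supp hF) ?mul0r ?normr0 ?mulr_ge0//; first exact: (le_trans _ (lbs_bound hF 0)).
  by have := normD_ge z e a a1 ee; lra.
- move=> z zr; rewrite (lbs_supp hF) ?mul0r//.
  by have := normD_ge z e a a1 ee; lra.
- by rewrite addr_ge0.
Qed.

(** Translation by [- a e - b e'] turns the first product into the second. The pairing involves
    shifts of both signs, which is why the differences are central: the products produced by
    one-sided differences are not matched in this way. *)
Lemma integral_FG_swap (a b : R) (e e' : phase R) :
  `|a| <= 1 -> `|b| <= 1 -> `|e| <= 1 -> `|e'| <= 1 ->
  \int[mu4]_z (F (z + a *: e) * G (z + b *: e') - F (z + (- b) *: e') * G (z + (- a) *: e)) = 0.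
Proof.
move=> a1 b1 ee ee'.
have i1 := integrable_FG a b e e' a1 b1 ee ee'.
have i2 : mu4.-integrable setT (EFin \o (fun z => F (z + (- b) *: e') * G (z + (- a) *: e))).
  by apply: integrable_FG; rewrite ?normrN.
have [_ ->] := integrable_RintegralB _ _ i1 i2.
apply/eqP; rewrite subr_eq0; apply/eqP; rewrite -(Rintegral_shift4 _ (- (a *: e) - b *: e') i1).
apply: eq_Rintegral => z _; rewrite !scaleNr.
by congr (F _ * G _); rewrite -!addrA; congr (_ + _);
  [rewrite addrCA addNr addr0|rewrite addNr addr0].
Qed.

(** For each [n] the Jacobian of the central quotients has integral exactly 0; then let [n] tend to
    infinity. [G] will be the square of a potential, without bounded support, so only local bounds
    on it are available: with steps at most 1, a nonzero shifted [F] forces [|z| <= r + 1], and [G]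
    is then evaluated within radius [r + 2]. *)
Lemma jacobian0 : Znull (fun z => 'D_e1 F z * 'D_e2 G z - 'D_e2 F z * 'D_e1 G z).
Proof.
pose c (n : nat) : R := n.+1%:R^-1.
pose Cq (g : phase R -> R) e n (z : phase R) := (g (z + c n *: e) - g (z - c n *: e))
  / (2 * c n).
pose u n z := Cq F e1 n z * Cq G e2 n z - Cq F e2 n z * Cq G e1 n z.
have c1 n : `|c n| <= 1 by rewrite ger0_norm /c ?invr_ge0// invf_le1// ler1n.
have c0 n : 0 < c n by rewrite /c invr_gt0.
have mC g e n : measurable_fun [set: T4 R] g -> measurable_fun [set: T4 R] (Cq g e n).
  move=> mg; apply: measurable_funM => //; apply: measurable_funB.
    exact: (measurableT_comp mg (measurable_shift4 _)).
  exact: (measurableT_comp mg (measurable_shift4 _)).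
have den n : 0 < 2 * c n by rewrite mulr_gt0.
have gap e n (z : phase R) : `|e| <= 1 -> `|(z + c n *: e) - (z - c n *: e)| <= 2 * c n.
  move=> ee; rewrite opprD addrACA subrr add0r opprK -mulr2n normrMn normrZ.
  by rewrite (gtr0_norm (c0 n)) -[leLHS]mulr_natl ler_pM2l// ler_piMr// ltW.
have CF e n z : `|e| <= 1 -> `|Cq F e n z| <= L.
  move=> ee; rewrite /Cq normrM normfV (gtr0_norm (den n)) ler_pdivrMr//.
  by rewrite (le_trans (lbs_lip hF _ _))// ler_wpM2l ?(lbs_L hF)// gap.
have CF0 e n (z : phase R) : `|e| <= 1 -> r + 1 < `|z| -> Cq F e n z = 0.
  move=> ee zr; have A := normD_ge z e (c n) (c1 n) ee.
  have := normD_ge z e (- c n); rewrite normrN scaleNr => /(_ (c1 n) ee) B.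
  by rewrite /Cq !(lbs_supp hF) ?subrr ?mul0r//; lra.
have CG e n (z : phase R) : `|e| <= 1 -> `|z| <= r + 1 -> `|Cq G e n z| <= L'.
  move=> ee zr; rewrite /Cq normrM normfV (gtr0_norm (den n)) ler_pdivrMr//.
  have A := normD_le z e (c n) (c1 n) ee.
  have := normD_le z e (- c n); rewrite normrN scaleNr => /(_ (c1 n) ee) B.
  apply: (le_trans (GL _ _ _ _)); [lra|lra|].
  by rewrite ler_wpM2l// gap.
have u0 n : \int[mu4]_z u n z = 0.
  have nc : `|- c n| <= 1 by rewrite normrN.
  have sw a b e e' (a1 : `|a| <= 1) (b1 : `|b| <= 1) (ee : `|e| <= 1) (ee' : `|e'| <= 1) :
      Znull (fun z => F (z + a *: e) * G (z + b *: e') - F (z + (- b) *: e') * G (z + (- a)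
        *: e)).
    have i1 := integrable_FG a b e e' a1 b1 ee ee'.
    have i2 : mu4.-integrable setT (EFin \o (fun z => F (z + (- b) *: e') * G (z + (- a)
      *: e))).
      by apply: integrable_FG; rewrite ?normrN.
    by split; [exact: (integrable_RintegralB _ _ i1 i2).1|exact: integral_FG_swap].
  (* One null integral for each choice of signs: the expanded discrete Jacobian is
     [Z1 - Z2 - (Z3 - Z4)] divided by [(2 * c n) ^ 2]. *)
  have Z1 := sw _ _ _ _ (c1 n) (c1 n) e1_le1 e2_le1.
  have Z2 := sw _ _ _ _ (c1 n) nc e1_le1 e2_le1.
  have Z3 := sw _ _ _ _ nc (c1 n) e1_le1 e2_le1.
  have Z4 := sw _ _ _ _ nc nc e1_le1 e2_le1.
  have [_] := ZnullZ _ ((2 * c n)^-1 ^+ 2) (ZnullB _ _ (ZnullB _ _ Z1 Z2) (ZnullB _ _ Z3 Z4)).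
  move=> E; rewrite -[RHS]E; apply: eq_Rintegral => z _.
  by rewrite /u /Cq !opprK !scaleNr; ring.
have [] := dominated_cvg4 u (fun z => 'D_e1 F z * 'D_e2 G z - 'D_e2 F z * 'D_e1 G z)
  (fun z => (2 * L * L') * \1_(cball4 0 (r + 1)) z).
- by move=> n; apply: measurable_funB; apply: measurable_funM; exact: mC.
- move=> z; have [? ?] := dF z; have [? ?] := dG z.
  by apply: cvgB; apply: cvgM; exact: central_quotient_cvg.
- by apply: integrable_cst_cball; rewrite addr_ge0.
- move=> n z; have [zr|zr] := leP `|z| (r + 1).
    rewrite indic_cball1// mulr1 (le_trans (ler_normB _ _))//.
    rewrite (_ : 2 * L * L' = L * L' + L * L'); last by ring.
    by apply: lerD; rewrite normrM; apply: ler_pM => //; (exact: CF || exact: CG).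
  by rewrite /u !CF0// !mul0r subrr normr0 indic_cball0// mulr0.
move=> ij cj; split => //; move: cj; rewrite (_ : (fun n => _) = fun=> 0);
  last by apply/funext => n; exact: u0.
by move=> /cvg_lim => /(_ (@Rhausdorff R)) <-; rewrite lim_cst.
Qed.
End Jacobian.

(** * Derivative of the energy *)

Section Symmetry.
Context {R : realType}.
Variables (k : phase R -> R) (C : R).
Hypothesis kC : log_singular k C.

Let C0 := log_singular_ge0 kC.

Lemma ker_mass_mono (z z' : phase R) (r : R) : 0 <= r -> `|z| <= `|z'| ->
  ker_mass C z r <= ker_mass C z' r.
Proof.
move=> r0 zz; rewrite /ker_mass ler_wpM2l// lerD2r ler_wpM2r ?lerD2r//.
by rewrite exprn_ge0// mulr_ge0.
Qed.

Lemma ker_mass_ge0 (z : phase R) (r : R) : 0 <= r -> 0 <= ker_mass C z r.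
Proof.
move=> r0; rewrite /ker_mass mulr_ge0//.
by rewrite !(addr_ge0, mulr_ge0, exprn_ge0)// ?mulr_ge0.
Qed.

Lemma measurable_sub4 :
  measurable_fun [set: T4 R * T4 R] ((fun p : phase R * phase R => p.1 - p.2) : _ -> T4 R).
Proof.
have H (h : T4 R -> R) : measurable_fun [set: T4 R] h ->
    measurable_fun [set: T4 R * T4 R] (fun p => h p.1 - h p.2).
  move=> mh; apply: measurable_funB.
    exact: (measurableT_comp mh measurable_fst).
  exact: (measurableT_comp mh measurable_snd).
apply/measurable_fun_pair; apply/measurable_fun_pair.
- exact: (H _ (measurableT_comp measurable_fst measurable_fst)).
- exact: (H _ (measurableT_comp measurable_snd measurable_fst)).
- exact: (H _ (measurableT_comp measurable_fst measurable_snd)).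
- exact: (H _ (measurableT_comp measurable_snd measurable_snd)).
Qed.

(** [((r, 0), 0)] stands for any point of norm [r]: [ker_mass] depends on [z] through [|z|] and
    increases with it, so its value there serves the whole ball. *)
Lemma conv_mul_le (g1 g2 : phase R -> R) (M1 M2 r : R) (z : phase R) : 0 <= r ->
  measurable_fun [set: T4 R] g1 -> (forall y, `|g1 y| <= M1) ->
  (forall y : phase R, r < `|y| -> g1 y = 0) -> (forall y, `|g2 y| <= M2) ->
  (forall y : phase R, r < `|y| -> g2 y = 0) ->
  `|conv k g1 z * g2 z| <= M1 * ker_mass C (((r, 0), 0) : phase R) r * M2.
Proof.
move=> r0 mg1 gM1 g10 gM2 g20.
have M10 : 0 <= M1 by exact: le_trans (gM1 0).
have M20 : 0 <= M2 by exact: le_trans (gM2 0).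
have [zr|zr] := leP `|z| r; last first.
  rewrite g20// mulr0 normr0; apply: mulr_ge0 => //; apply: mulr_ge0 => //.
  exact: ker_mass_ge0.
rewrite normrM ler_pM//; apply: (le_trans (conv_bound _ _ kC z g1 M1 r r0 mg1 gM1 g10)).
rewrite ler_wpM2l// ker_mass_mono// (le_trans zr)// !prod_normE/= !le_max.
by rewrite (ler_norm r).
Qed.

(** Fubini for [k (z - y) * g1 y * g2 z], together with the evenness of [k]. Tonelli gives
    integrability: the inner integral of the absolute value is bounded on the ball of radius [r] and
    vanishes outside. *)
Lemma conv_symmetric (g1 g2 : phase R -> R) (M1 M2 r : R) : 0 <= r ->
  measurable_fun [set: T4 R] g1 -> (forall y, `|g1 y| <= M1) ->
  (forall y : phase R, r < `|y| -> g1 y = 0) ->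
  measurable_fun [set: T4 R] g2 -> (forall y, `|g2 y| <= M2) ->
  (forall y : phase R, r < `|y| -> g2 y = 0) ->
  \int[mu4]_z (conv k g1 z * g2 z) = \int[mu4]_z (conv k g2 z * g1 z).
Proof.
move=> r0 mg1 gM1 g10 mg2 gM2 g20.
pose H (p : phase R * phase R) := k (p.1 - p.2) * g1 p.2 * g2 p.1.
have mH : measurable_fun [set: T4 R * T4 R] (EFin \o H).
  apply/measurable_EFinP; apply: measurable_funM; first apply: measurable_funM.
  - exact: (measurableT_comp (log_singular_meas kC) measurable_sub4).
  - exact: (measurableT_comp mg1 measurable_snd).
  - exact: (measurableT_comp mg2 measurable_fst).
have inner1 z : (\int[mu4]_y (H (z, y))%:E = (conv k g1 z * g2 z)%:E)%E.
  have ig := integrable_ker_mul _ _ kC z g1 M1 r r0 mg1 gM1 g10.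
  rewrite /conv -RintegralZr// /Rintegral fineK//.
  apply: integrable_fin_num => //.
  rewrite (_ : (fun y => _) = (fun y => (k (z - y) * g1 y)%:E * (g2 z)%:E)%E)//.
  exact: integrableZr.
have inner2 y : (\int[mu4]_z (H (z, y))%:E = (conv k g2 y * g1 y)%:E)%E.
  have ig := integrable_ker_mul _ _ kC y g2 M2 r r0 mg2 gM2 g20.
  rewrite /conv -RintegralZr// /Rintegral fineK.
    apply: eq_integral => z _; rewrite /H /= -(log_singular_even kC) opprB.
    by congr EFin; ring.
  apply: integrable_fin_num => //.
  rewrite (_ : (fun z => _) = (fun z => (k (y - z) * g2 z)%:E * (g1 y)%:E)%E)//.
  exact: integrableZr.
have iH : (mu4 \x mu4)%E.-integrable setT (EFin \o H).
  apply/integrable12ltyP => //.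
  pose K := M1 * ker_mass C (((r, 0), 0) : phase R) r * M2.
  apply: (@le_lt_trans _ _ (\int[mu4]_z (K * \1_(cball4 (0 : phase R) r) z)%:E)%E); last first.
    exact: (integrable_lty measurableT (integrable_cst_cball K r r0)).
  apply: ge0_le_integral => //.
  - by move=> z _; apply: integral_ge0.
  - have mabs : measurable_fun [set: T4 R * T4 R] (abse \o (EFin \o H)).
      exact: measurableT_comp.
    have := @measurable_fun_fubini_tonelli_F _ _ (T4 R) (T4 R) R mu4 _ mabs (fun=> abse_ge0 _).
    exact.
  - exact: measurable_int (integrable_cst_cball K r r0).
  move=> z _.
  have M10 : 0 <= M1 by exact: le_trans (gM1 0).
  have M20 : 0 <= M2 by exact: le_trans (gM2 0).
  have [zr|zr] := leP `|z| r; last first.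
    rewrite indic_cball0// mulr0 integral0_eq// => y _.
    by rewrite /= /H /= g20// mulr0 normr0.
  apply: (@le_trans _ _ (\int[mu4]_y ((M1 * M2)%:E * (`|k (z - y)| * \1_(cball4 0 r)
    y)%:E)%E)%E).
    apply: ge0_le_integral => //.
    - have mz : measurable_fun [set: T4 R] (fun y => k (z - y) * g1 y * g2 z).
        by apply: measurable_funM => //; exact: (measurable_ker_mul _ _ kC).
      by do 2 apply: measurableT_comp => //.
    - by apply/measurable_EFinP; apply: measurable_funM => //;
      exact: measurable_ker_cball _ _ kC _ _.
    - move=> y _; rewrite /= -EFinM lee_fin /H /= normrM mulrAC.
      by apply: ler_pM => //; exact: ker_mul_le.
  rewrite ge0_integralZl_EFin//; last 2 first.
  - by apply/measurable_EFinP; exact: measurable_ker_cball _ _ kC _ _.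
  - exact: mulr_ge0.
  rewrite indic_cball1// mulr1.
  apply: (@le_trans _ _ ((M1 * M2)%:E * (ker_mass C z r)%:E)%E).
    by apply: lee_wpmul2l; [rewrite lee_fin mulr_ge0|exact: ker_mass_le].
  rewrite -EFinM lee_fin /K mulrAC; apply: ler_wpM2r => //; apply: ler_wpM2l => //.
  rewrite ker_mass_mono// (le_trans zr)// !prod_normE/= !le_max.
  by rewrite (ler_norm r).
have := Fubini iH.
rewrite /=; under eq_integral do rewrite inner1.
under [X in _ = X -> _]eq_integral do rewrite inner2.
by rewrite /Rintegral => ->.
Qed.
End Symmetry.

(** * Directional derivatives on the phase space and on its two planes *)

Section Directions.
Context {R : realType}.

Lemma quotient_fst4 (g : phase R -> R) (z : phase R) (a : plane R) :
  (fun h : R => h^-1 *: (g (h *: (a, 0) + z) - g z)) =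
  (fun h : R => h^-1 *: (g (h *: a + z.1, z.2) - g (z.1, z.2))).
Proof.
case: z => x v; apply/funext => h; congr (_ *: (g _ - _)).
by rewrite [LHS]surjective_pairing/= scaler0 add0r.
Qed.

Lemma quotient_snd4 (g : phase R -> R) (z : phase R) (a : plane R) :
  (fun h : R => h^-1 *: (g (h *: (0, a) + z) - g z)) =
  (fun h : R => h^-1 *: (g (z.1, h *: a + z.2) - g (z.1, z.2))).
Proof.
case: z => x v; apply/funext => h; congr (_ *: (g _ - _)).
by rewrite [LHS]surjective_pairing/= scaler0 add0r.
Qed.

Lemma derive_fst4 (g : phase R -> R) (z : phase R) (a : plane R) :
  'D_((a, 0) : phase R) g z = 'D_a (fun x => g (x, z.2)) z.1.
Proof. by rewrite /derive /= quotient_fst4. Qed.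

Lemma derive_snd4 (g : phase R -> R) (z : phase R) (a : plane R) :
  'D_((0, a) : phase R) g z = 'D_a (fun v => g (z.1, v)) z.2.
Proof. by rewrite /derive /= quotient_snd4. Qed.

Lemma derivable_fst4 (g : phase R -> R) (z : phase R) (a : plane R) :
  derivable (fun x => g (x, z.2)) z.1 a -> derivable g z ((a, 0) : phase R).
Proof. by rewrite /derivable /= quotient_fst4. Qed.

Lemma derivable_snd4 (g : phase R -> R) (z : phase R) (a : plane R) :
  derivable (fun v => g (z.1, v)) z.2 a -> derivable g z ((0, a) : phase R).
Proof. by rewrite /derivable /= quotient_snd4. Qed.
End Directions.

(** * Application to the solution *)

Section Solution.
Context {R : realType}.

Lemma continuous_eps (V : normedModType R) (h : V -> R) :
  (forall z e, 0 < e -> exists2 d, 0 < d & forall y, `|y - z| < d -> `|h y - h z| <= e) ->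
  continuous h.
Proof.
move=> H z; apply/cvgrPdist_le => e e0; have [d d0 hd] := H z e e0.
apply/nbhs_ballP; exists d => //= y; rewrite -ball_normE /= distrC => yd.
by rewrite distrC; exact: hd.
Qed.

Lemma continuous_Rplus_bounded (p : R -> plane R -> plane R -> R) (T r : R) :
  continuous_Rplus p -> 0 <= T -> 0 <= r ->
  exists B, forall t (z : phase R), 0 <= t <= T -> `|z| <= r -> `|p t z.1 z.2| <= B.
Proof.
move=> cp T0 r0.
pose K : set (R * phase R) := [set` `[0, T]] `*` [set z : phase R | `|0 - z| <= r].
have cK : compact K by have := compact_setX (@segment_compact R 0 T)
  (compact_cball4 R 0 r); exact.
have K0 : K !=set0.
  by exists (0, 0); split; rewrite /= ?in_itv/= ?lexx ?subr0 ?normr0.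
have pK : {within K, continuous (fun q : R * phase R => `|p q.1 q.2.1 q.2.2|)}.
  apply/subspace_continuousP => q Kq; apply: cvg_norm.
  have /subspace_continuousP : {within K, continuous (fun q : R * phase R => p q.1 q.2.1
    q.2.2)}.
    apply: continuous_subspaceW cp => a [/= aT _]; split => //=.
    by move: aT; rewrite in_itv/= => /andP[].
  exact.
have [q _ qmax] := compact_EVT_max K0 cK pK.
exists `|p q.1 q.2.1 q.2.2| => t z tT zr; apply: (qmax (t, z)); rewrite inE.
by split; rewrite /= ?in_itv//= sub0r normrN.
Qed.

Lemma norm_perp (w : plane R) : `|perp w| = `|w|.
Proof. by rewrite !prod_normE/= normrN maxC. Qed.

Lemma norm_scale_perp (c : R) (w : plane R) : `|c *: perp w| = `|c| * `|w|.
Proof. by rewrite normrZ norm_perp. Qed.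

Lemma norm_grad_le (h : plane R -> R) (L : R) : 0 <= L ->
  (forall a b, `|h a - h b| <= L * `|a - b|) -> forall x, `|grad h x| <= L.
Proof.
move=> L0 hL x.
have n1 : `|(1, 0) : plane R| <= 1 by rewrite prod_normE/= ge_max normr1 normr0 lexx ler01.
have n2 : `|(0, 1) : plane R| <= 1 by rewrite prod_normE/= ge_max normr1 normr0 lexx ler01.
rewrite prod_normE/= ge_max; apply/andP; split.
  by rewrite (le_trans (norm_derive_le _ _ h L L0 hL _ _))// ler_piMr.
by rewrite (le_trans (norm_derive_le _ _ h L L0 hL _ _))// ler_piMr.
Qed.

Variables (wc : R) (fin : plane R -> plane R -> R) (f : R -> plane R -> plane R -> R).
Hypothesis wc0 : wc != 0.
Hypothesis fin_supp : compactly_supported (fun p => fin p.1 p.2).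
Hypothesis hf : solution wc fin f.

Let fC1 := sol_C1 hf.
Let k := logker wc.
Let kC := logker_log_singular R wc wc0.
Let u t (z : phase R) := f t z.1 z.2.

Lemma solution_continuous t : 0 <= t -> continuous (u t).
Proof.
move=> t0; apply: continuous_eps => z e e0.
have [d d0 hd] := continuous_RplusP _ (C1_cont fC1) t z t0 e e0.
by exists d => // y yd; apply: hd => //; rewrite subrr normr0.
Qed.

Lemma solution_measurable t : 0 <= t -> measurable_fun [set: T4 R] (u t).
Proof. by move=> t0; apply: continuous_measurable4; exact: solution_continuous. Qed.

Lemma solution_ker_integrable t z : 0 <= t ->
  mu4.-integrable setT (fun y => (k (z - y) * u t y)%:E).
Proof.
case: z => x v t0; have := @sol_potential _ _ _ _ hf t x v t0.
rewrite (_ : (fun p => _) = (fun y => (k ((x, v) - y) * u t y)%:E))//.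
by apply/funext => -[y w]; rewrite pot_kernelE.
Qed.

Lemma potentialE t x v : 0 <= t -> potential wc (f t) x v = conv k (u t) (x, v).
Proof.
move=> t0; have := @Rintegral_prod _ _ (T2 R) (T2 R) R mu2 mu2 (fun y => k ((x, v) - y)
  * u t y) (solution_ker_integrable t (x, v) t0).
rewrite /conv /mu4 => <-; rewrite /potential.
by apply: eq_Rintegral => y _; apply: eq_Rintegral => w _; rewrite pot_kernelE.
Qed.

Definition field t (z : phase R) : phase R :=
  (fieldV wc (f t) z.1 z.2, fieldA wc (f t) z.1 z.2).

Lemma conv_lip_unif (T : R) : exists2 L, 0 <= L &
  forall t, 0 <= t <= T -> forall a b, `|conv k (u t) a - conv k (u t) b| <= L * `|a - b|.
Proof.
have [C hC] := kC.
have [M0 hM0] := sol_bounded hf T; have [B0 hB0] := sol_L1 hf T.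
have C0 := log_singular_ge0 hC.
exists (C * (2 * (64 * `|M0| + `|B0|))).
  by rewrite !(mulr_ge0, addr_ge0).
move=> t tT; have /andP[t0 _] := tT.
apply: (conv_lip _ _ hC) => //.
- exact: solution_measurable.
- by move=> z; rewrite (le_trans (hM0 _ _ _ tT))// ler_norm.
- by apply: (le_trans (hB0 _ tT)); rewrite lee_fin ler_norm.
- by move=> z; exact: solution_ker_integrable.
Qed.

(** Only the Lipschitz bound on the potential is at hand; [norm_derive_le] bounds the gradient
    whether or not the partial derivatives exist. *)
Lemma field_bounded (T : R) : exists2 Bd, 0 <= Bd &
  forall t z, 0 <= t <= T -> `|field t z| <= Bd.
Proof.
have [L L0 hL] := conv_lip_unif T.
exists ((`|wc|^-1 + `|wc|) * L).
  by rewrite mulr_ge0// addr_ge0// invr_ge0.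
move=> t z tT; have /andP[t0 _] := tT.
have hx : `|grad (fun x' => potential wc (f t) x' z.2) z.1| <= L.
  apply: norm_grad_le => // a b; rewrite !potentialE//.
  rewrite (le_trans (hL _ tT _ _))// ler_wpM2l//.
  by rewrite prod_normE/= ge_max lexx/= subrr normr0.
have hv : `|grad (fun v' => potential wc (f t) z.1 v') z.2| <= L.
  apply: norm_grad_le => // a b; rewrite !potentialE//.
  rewrite (le_trans (hL _ tT _ _))// ler_wpM2l//.
  by rewrite prod_normE/= ge_max lexx/= subrr normr0 normr_ge0.
have i0 : 0 <= `|wc|^-1 by rewrite invr_ge0.
rewrite prod_normE ge_max mulrDl; apply/andP; split.
  apply: (@le_trans _ _ (`|wc|^-1 * L)); last by rewrite lerDl mulr_ge0.
  rewrite [X in X <= _](_ : _ = `|wc|^-1 * `|grad (fun x' => potential wc (f t) x' z.2) z.1|).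
    exact (ler_wpM2l i0 hx).
  rewrite -normfV -(normrN wc^-1).
  exact (norm_scale_perp (- wc^-1) (grad (fun x' => potential wc (f t) x' z.2) z.1)).
apply: (@le_trans _ _ (`|wc| * L)); last by rewrite lerDr mulr_ge0.
rewrite [X in X <= _](_ : _ = `|wc| * `|grad (fun v' => potential wc (f t) z.1 v') z.2|).
  exact (ler_wpM2l (normr_ge0 wc) hv).
exact (norm_scale_perp wc (grad (fun v' => potential wc (f t) z.1 v') z.2)).
Qed.

Lemma initial_support : exists2 rho, 0 <= rho &
  forall z : phase R, rho < `|z| -> f 0 z.1 z.2 = 0.
Proof.
have /compact_bounded[N [_ hN]] := fin_supp.
have [r0 r00 hr] : exists2 r0, 0 <= r0 & forall p : phase R, fin p.1 p.2 != 0 -> `|p| <= r0.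
  exists (`|N| + 1); first by rewrite addr_ge0.
  move=> p fp; apply: (hN (`|N| + 1)); first by rewrite ltr_pwDr// ler_norm.
  exact: subset_closure.
(* The second term pays for the shift by [wc^-1 *: perp v] in the initial condition. *)
exists (r0 + `|wc^-1| * r0); first by rewrite addr_ge0// mulr_ge0.
move=> z; rewrite ltNge => /negP H; apply/eqP/negP => /negP; rewrite (sol_init hf) => h.
have := hr (z.1 - wc^-1 *: perp z.2, z.2) h.
rewrite prod_normE ge_max /= => /andP[h1 h2]; apply: H.
rewrite prod_normE ge_max; apply/andP; split; last first.
  by rewrite (le_trans h2)// lerDl mulr_ge0.
rewrite -(subrK (wc^-1 *: perp z.2) z.1) (le_trans (ler_normD _ _))// lerD//.
by rewrite normrZ norm_perp ler_wpM2l.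
Qed.

Lemma solution_support (T : R) : exists2 r, 0 <= r &
  forall t (z : phase R), 0 <= t <= T -> r < `|z| -> u t z = 0.
Proof.
have [T0|T0] := ltP T 0.
  by exists 0 => // t z /andP[t0 /(le_trans t0)]; rewrite leNgt T0.
have [Bd Bd0 hB] := field_bounded T; have [rho rho0 hrho] := initial_support.
exists (rho + Bd * T); first by rewrite addr_ge0// mulr_ge0.
apply: (support_propagation f fC1 field T Bd hB) => // t z /andP[t0 _].
exact: (sol_eq hf).
Qed.

(** The constants are uniform on [[0, T]], as dominated convergence along times tending to [t]
    requires. *)
Lemma solution_lbs (T : R) : 0 <= T -> exists M L r D, 0 <= D /\
  (forall t, 0 <= t <= T -> lip_bounded_support (u t) M L r) /\
  (forall s t z, 0 <= s <= T -> 0 <= t <= T -> `|u s z - u t z| <= D * `|s - t|).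
Proof.
move=> T0; have [r r0 hr] := solution_support T.
have [M0 hM0] := sol_bounded hf T.
have r20 : 0 <= r + 2 by rewrite addr_ge0.
(* [MVT_Rplus] places the intermediate time only within [|s - t|] of [t], hence in [[0, T + T]]. *)
have [Bt hBt] := continuous_Rplus_bounded _ (T + T) (r + 2) (C1_dt_cont fC1)
  (addr_ge0 T0 T0) r20.
have [B1 hB1] := continuous_Rplus_bounded _ T (r + 2) (proj1 (C1_dx_cont fC1)) T0 r20.
have [B2 hB2] := continuous_Rplus_bounded _ T (r + 2) (proj2 (C1_dx_cont fC1)) T0 r20.
have [B3 hB3] := continuous_Rplus_bounded _ T (r + 2) (proj1 (C1_dv_cont fC1)) T0 r20.
have [B4 hB4] := continuous_Rplus_bounded _ T (r + 2) (proj2 (C1_dv_cont fC1)) T0 r20.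
pose B := `|B1| + `|B2| + (`|B3| + `|B4|).
pose M := `|M0|.
have B0 : 0 <= B by rewrite !addr_ge0.
have M_ge0 : 0 <= M by exact: normr_ge0.
(* [B] handles points at distance at most 1, whose intermediate points stay within radius [r + 2]
   unless both values vanish; beyond distance 1, [2 * M] suffices. *)
exists M, (B + 2 * M), r, `|Bt|; split => //; split.
  move=> t tT; have /andP[t0 _] := tT.
  have uM z : `|u t z| <= M by rewrite (le_trans (hM0 _ _ _ tT))// ler_norm.
  split => //; first by rewrite addr_ge0// mulr_ge0.
  - move=> a b; have [ab|ab] := leP `|a - b| 1; last first.
      rewrite (le_trans (ler_normB _ _))// (@le_trans _ _ (2 * M * `|a - b|))//.
        have := uM a; have := uM b => ub ua.
        have : M * 1 <= M * `|a - b| by rewrite ler_wpM2l// ltW.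
        lra.
      by rewrite ler_wpM2r// lerDr.
    have [br|br] := leP `|b| (r + 1); last first.
      have ar : r < `|a|.
        have := ler_normB a (a - b); rewrite subKr; lra.
      rewrite !hr ?subrr ?normr0//; first by rewrite mulr_ge0// addr_ge0// mulr_ge0.
      lra.
    have [c [p1 [p2 [q1 [q2 [_ [p1s p2s] [q1s q2s] E]]]]]] := increment f fC1 t t b a t0 t0.
    rewrite /u E subrr mulr0 add0r.
    have near p : `|p - b| <= `|a - b| -> `|p| <= r + 2.
      move=> pb; have := ler_normD (p - b) b; rewrite subrK; lra.
    have [n1 n2 n3 n4] := norm_coord (a - b).
    have Mx (x y N : R) : `|x| <= N -> `|y| <= `|a - b| -> `|x * y| <= `|N| * `|a - b|.
      by move=> xN yn; rewrite normrM ler_pM// (le_trans xN)// ler_norm.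
    apply: (@le_trans _ _ (B * `|a - b|)); last by rewrite ler_wpM2r// lerDl mulr_ge0.
    rewrite !mulrDl; apply: (le_trans (ler_normD _ _)); apply: lerD;
      apply: (le_trans (ler_normD _ _)); apply: lerD; apply: Mx => //.
    + by apply: hB1 => //; exact: near.
    + by apply: hB2 => //; exact: near.
    + by apply: hB3 => //; exact: near.
    + by apply: hB4 => //; exact: near.
  - by move=> z; exact: hr.
move=> s t z sT tT; have /andP[s0 s1] := sT; have /andP[t0 t1] := tT.
have [zr|zr] := leP `|z| r; last by rewrite !hr// subrr normr0 mulr_ge0.
have [c [c0 cs E]] := MVT_Rplus (fun s => f s z.1 z.2) t s
  (fun q => @C1_dt _ _ fC1 q _ _) t0 s0.
rewrite /u E normrM ler_wpM2r// (le_trans (hBt _ _ _ _)) ?ler_norm//.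
  rewrite c0 /=; move: cs; have [st|st] := leP t s.
    by rewrite (@ger0_norm _ (s - t)) ?subr_ge0// ler_norml => /andP[]; lra.
  by rewrite (@ltr0_norm _ (s - t)) ?subr_lt0// ler_norml => /andP[]; lra.
by rewrite (le_trans zr)// lerDl.
Qed.

Let e1 : phase R := ((1, 0), 0).
Let e2 : phase R := ((0, 1), 0).
Let e3 : phase R := (0, (1, 0)).
Let e4 : phase R := (0, (0, 1)).

Lemma unit_norms : [/\ `|e1| <= 1, `|e2| <= 1, `|e3| <= 1 & `|e4| <= 1].
Proof.
by split; apply: norm_phase_le; rewrite /= ?normr1 ?normr0 ?lexx ?ler01.
Qed.

Lemma solution_derivable t z : 0 <= t ->
  (derivable (u t) z e1 /\ derivable (u t) z e2) /\
  (derivable (u t) z e3 /\ derivable (u t) z e4).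
Proof.
move=> t0; have [x1 x2] := @C1_dx _ _ fC1 t z.1 z.2 t0.
have [v1 v2] := @C1_dv _ _ fC1 t z.1 z.2 t0.
exact (conj (conj (derivable_fst4 (u t) z (1, 0) x1) (derivable_fst4 (u t) z (0, 1) x2))
  (conj (derivable_snd4 (u t) z (1, 0) v1) (derivable_snd4 (u t) z (0, 1) v2))).
Qed.

Lemma transport_solve (a b pt : R) (gx hx gv hv : plane R) :
  pt + dot (- a *: perp gx) hx + dot (b *: perp gv) hv = 0 ->
  pt = a * (hx.1 * gx.2 - hx.2 * gx.1) - b * (hv.1 * gv.2 - hv.2 * gv.1).
Proof.
rewrite /dot /perp /=; have sc (c d : R) : c *: d = c * d by [].
by rewrite !sc => H; rewrite -[LHS]subr0 -H; ring.
Qed.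

Lemma sol_eq_directions t z : 0 <= t -> let phi := conv k (u t) in
  part_t f t z =
    wc^-1 * ('D_e1 (u t) z * 'D_e2 phi z - 'D_e2 (u t) z * 'D_e1 phi z) -
    wc * ('D_e3 (u t) z * 'D_e4 phi z - 'D_e4 (u t) z * 'D_e3 phi z).
Proof.
move=> t0 phi.
have Ex : (fun x' => potential wc (f t) x' z.2) = (fun x => phi (x, z.2)).
  by apply/funext => x; exact: potentialE.
have Ev : (fun v' => potential wc (f t) z.1 v') = (fun v => phi (z.1, v)).
  by apply/funext => v; exact: potentialE.
have EV : fieldV wc (f t) z.1 z.2 = (- wc^-1) *: perp (grad (fun x => phi (x, z.2)) z.1).
  exact (f_equal (fun h => (- wc^-1) *: perp (grad h z.1)) Ex).
have EA : fieldA wc (f t) z.1 z.2 = wc *: perp (grad (fun v => phi (z.1, v)) z.2).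
  exact (f_equal (fun h => wc *: perp (grad h z.2)) Ev).
have H := @sol_eq _ _ _ _ hf t z.1 z.2 t0.
rewrite EV EA in H.
rewrite (derive_fst4 phi z (1, 0)) (derive_fst4 phi z (0, 1)).
rewrite (derive_snd4 phi z (1, 0)) (derive_snd4 phi z (0, 1)).
rewrite (derive_fst4 (u t) z (1, 0)) (derive_fst4 (u t) z (0, 1)).
rewrite (derive_snd4 (u t) z (1, 0)) (derive_snd4 (u t) z (0, 1)).
exact (transport_solve _ _ _ _ _ _ _ H).
Qed.

(** The [d]'s are derivatives of the potential and the [g]'s those of its square. Since
    [phi * J(f, phi) = J(f, phi ^ 2) / 2], multiplying the equation by the potential leaves
    Jacobians on the other side. *)
Lemma flux_identity (p pt a1 a2 a3 a4 d1 d2 d3 d4 g1 g2 g3 g4 : R) :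
  g1 = 2 * p * d1 -> g2 = 2 * p * d2 -> g3 = 2 * p * d3 -> g4 = 2 * p * d4 ->
  pt = wc^-1 * (a1 * d2 - a2 * d1) - wc * (a3 * d4 - a4 * d3) ->
  wc^-1 / 2 * (a1 * g2 - a2 * g1) - wc / 2 * (a3 * g4 - a4 * g3) = p * pt.
Proof. by move=> -> -> -> -> ->; field; exact: wc0. Qed.

Lemma conv_dt_null t : 0 <= t -> Znull (fun z => conv k (u t) z * part_t f t z).
Proof.
move=> t0; have tT : 0 <= t <= t by rewrite t0 lexx.
have [C hC] := kC.
have [M [L [r [D [D0 [hu _]]]]]] := solution_lbs t t0.
have {}hu := hu t tT.
have [Lp Lp0 hLp] := conv_lip_unif t.
have {}hLp := hLp t tT.
set phi := conv k (u t) in hLp *.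
have r0 := lbs_r hu.
have r20 : 0 <= r + 2 by rewrite addr_ge0.
pose Mp := `|phi 0| + Lp * (r + 2).
have Mp0 : 0 <= Mp by rewrite addr_ge0// mulr_ge0.
have phiM (z : phase R) : `|z| <= r + 2 -> `|phi z| <= Mp.
  move=> zr; rewrite -[phi z](subrK (phi 0)) (le_trans (ler_normD _ _))// addrC lerD2l.
  by rewrite (le_trans (hLp _ _))// subr0 ler_wpM2l.
pose G z := phi z * phi z.
have mphi : measurable_fun [set: T4 R] phi.
  by apply: continuous_measurable4; exact: lipschitz_continuous hLp.
have mG : measurable_fun [set: T4 R] G by exact: measurable_funM.
have GM (z : phase R) : `|z| <= r + 2 -> `|G z| <= Mp * Mp.
  by move=> zr; rewrite normrM ler_pM// phiM.
have LG0 : 0 <= 2 * Mp * Lp by rewrite !mulr_ge0.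
have GL (a b : phase R) : `|a| <= r + 2 -> `|b| <= r + 2 -> `|G a - G b| <= (2 * Mp * Lp)
  * `|a - b|.
  move=> ar br; rewrite /G.
  have sqrB (x y : R) : x * x - y * y = (x + y) * (x - y) by ring.
  rewrite sqrB normrM -mulrA ler_pM//.
  by rewrite (le_trans (ler_normD _ _))// mulr_natl mulr2n lerD// phiM.
have [n1 n2 n3 n4] := unit_norms.
have dphi e : (forall z, derivable (u t) z e) -> forall z, derivable phi z e.
  by move=> du; exact: (conv_derivable _ _ hC _ _ _ _ _ hu du).
have d1 z : derivable (u t) z e1 by have [[]] := solution_derivable t z t0.
have d2 z : derivable (u t) z e2 by have [[]] := solution_derivable t z t0.
have d3 z : derivable (u t) z e3 by have [_ []] := solution_derivable t z t0.
have d4 z : derivable (u t) z e4 by have [_ []] := solution_derivable t z t0.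
have dG e : (forall z, derivable (u t) z e) -> forall z, derivable G z e.
  by move=> /dphi dp z; exact: derivableM.
have DG e : (forall z, derivable (u t) z e) -> forall z, 'D_e G z = 2 * phi z * 'D_e phi z.
  move=> /dphi dp z; rewrite /G deriveM//.
  have sc (a b : R) : a *: b = a * b by [].
  by rewrite !sc; ring.
have J1 := jacobian0 _ _ _ _ _ _ _ _ _ hu n1 n2 mG GM LG0 GL
  (fun z => conj (d1 z) (d2 z)) (fun z => conj (dG _ d1 z) (dG _ d2 z)).
have J2 := jacobian0 _ _ _ _ _ _ _ _ _ hu n3 n4 mG GM LG0 GL
  (fun z => conj (d3 z) (d4 z)) (fun z => conj (dG _ d3 z) (dG _ d4 z)).
have := ZnullB _ _ (ZnullZ _ (wc^-1 / 2) J1) (ZnullZ _ (wc / 2) J2).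
congr Znull; apply/funext => z.
exact (flux_identity _ _ _ _ _ _ _ _ _ _ _ _ _ _ (DG _ d1 z) (DG _ d2 z) (DG _ d3 z) (DG _ d4 z)
  (sol_eq_directions t z t0)).
Qed.

Lemma energyE t : 0 <= t -> energy wc (f t) = 2^-1 * \int[mu4]_z (conv k (u t) z * u t z).
Proof.
move=> t0; have tT : 0 <= t <= t by rewrite t0 lexx.
have [C hC] := kC.
have [M [L [r [D [D0 [hu _]]]]]] := solution_lbs t t0.
have {}hu := hu t tT.
have [Lp Lp0 hLp] := conv_lip_unif t.
have iE : (mu2 \x mu2)%E.-integrable setT (EFin \o (fun z => conv k (u t) z * u t z)).
  apply: (@integrable_bounded_support _ _ (M * ker_mass C (((r, 0), 0) : phase R) r * M) r).
  - apply: measurable_funM; last exact: solution_measurable.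
    by apply: continuous_measurable4; exact: lipschitz_continuous (hLp t tT).
  - move=> z; apply: (conv_mul_le _ _ hC);
    [exact: (lbs_r hu)|exact: solution_measurable| | | |].
    + exact: (lbs_bound hu).
    + exact: (lbs_supp hu).
    + exact: (lbs_bound hu).
    + exact: (lbs_supp hu).
  - by move=> z zr; rewrite (lbs_supp hu)// mulr0.
  - exact: (lbs_r hu).
rewrite /energy; congr (_ * _).
have E := @Rintegral_prod _ _ (T2 R) (T2 R) R mu2 mu2 _ iE.
refine (etrans _ E).
apply: eq_Rintegral => x _; apply: eq_Rintegral => v _.
exact (f_equal (fun a => a * f t x v) (potentialE t x v t0)).
Qed.

Lemma conv_mul_integrable (T M L r : R) (s t : R) :
  (forall t, 0 <= t <= T -> lip_bounded_support (u t) M L r) ->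
  0 <= s <= T -> 0 <= t <= T ->
  mu4.-integrable setT (EFin \o (fun z => conv k (u s) z * u t z)).
Proof.
move=> hu sT tT; have [C hC] := kC.
have [Lp Lp0 hLp] := conv_lip_unif T.
apply: (@integrable_bounded_support _ _ (M * ker_mass C (((r, 0), 0) : phase R) r * M) r).
- apply: measurable_funM; last exact: lbs_measurable _ _ _ _ (hu t tT).
  by apply: continuous_measurable4; exact: lipschitz_continuous (hLp s sT).
- move=> z; exact (conv_mul_le _ _ hC _ _ _ _ _ _ (lbs_r (hu s sT))
  (lbs_measurable _ _ _ _ (hu s sT))
    (lbs_bound (hu s sT)) (lbs_supp (hu s sT)) (lbs_bound (hu t tT)) (lbs_supp (hu t tT))).
- by move=> z zr; rewrite (lbs_supp (hu t tT))// mulr0.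
- exact: (lbs_r (hu t tT)).
Qed.

Lemma energyB (T M L r : R) (s t : R) :
  (forall t, 0 <= t <= T -> lip_bounded_support (u t) M L r) ->
  0 <= s <= T -> 0 <= t <= T ->
  let h := fun z => (conv k (u s) z + conv k (u t) z) * (u s z - u t z) in
  mu4.-integrable setT (EFin \o h) /\
  energy wc (f s) - energy wc (f t) = 2^-1 * \int[mu4]_z h z.
Proof.
move=> hu sT tT h; have [C hC] := kC.
have /andP[s0 _] := sT; have /andP[t0 _] := tT.
have ss := conv_mul_integrable T M L r s s hu sT sT.
have st := conv_mul_integrable T M L r s t hu sT tT.
have ts := conv_mul_integrable T M L r t s hu tT sT.
have tt := conv_mul_integrable T M L r t t hu tT tT.
(* Symmetry makes the two cross terms between the times [s] and [t] equal, so they cancel. *)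
have sym := conv_symmetric _ _ hC _ _ _ _ _ (lbs_r (hu s sT))
  (lbs_measurable _ _ _ _ (hu s sT)) (lbs_bound (hu s sT)) (lbs_supp (hu s sT))
  (lbs_measurable _ _ _ _ (hu t tT)) (lbs_bound (hu t tT)) (lbs_supp (hu t tT)).
have [i1 E1] := integrable_RintegralB _ _ ss st.
have [i2 E2] := integrable_RintegralB _ _ tt ts.
have [i3 E3] := integrable_RintegralB _ _ i1 i2.
have -> : h = (fun z => conv k (u s) z * u s z - conv k (u s) z * u t z -
  (conv k (u t) z * u t z - conv k (u t) z * u s z)).
  by apply/funext => z; rewrite /h; ring.
split; first exact i3.
rewrite (energyE s s0) (energyE t t0) -mulrBr; congr (_ * _).
have subrBB (x y w : R) : x - y = x - w - (y - w) by ring.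
by rewrite E3 E1 E2 sym; exact: subrBB.
Qed.

(** In the factored form of [energyB] the potential is never differentiated in time: it only has to
    converge pointwise, while the difference quotient falls on [f]. *)
Lemma energy_derivative (t : R) : 0 <= t -> is_dRplus (fun s => energy wc (f s)) t 0.
Proof.
move=> t0; have [C hC] := kC.
have T0 : 0 <= t + 1 by rewrite addr_ge0.
have tT : 0 <= t <= t + 1 by rewrite t0 lerDl ler01.
have [M [L [r [D [D0 [hu hD]]]]]] := solution_lbs (t + 1) T0.
have r0 := lbs_r (hu t tT).
have M0 : 0 <= M by exact: le_trans (lbs_bound (hu t tT) 0).
have [_ null] := conv_dt_null t t0.
apply/is_dRplusP; apply: (limit_by_sequences _ Rplus) => v vP vt.
have vT n : 0 <= v n <= t + 1.
  have [v0 _ v1] := vP n; apply/andP; split; first exact: v0.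
  by rewrite -lerBlDl (le_trans (ler_norm _)).
have vt0 n : v n - t != 0 by have [_ + _] := vP n; rewrite subr_eq0.
pose w n z := 2^-1 * (conv k (u (v n)) z + conv k (u t) z) * ((u (v n) z - u t z) / (v n - t)).
have QE n : (energy wc (f (v n)) - energy wc (f t)) / (v n - t) = \int[mu4]_z w n z.
  have [iX ->] := energyB (t + 1) M L r (v n) t hu (vT n) tT.
  rewrite mulrAC -RintegralZl//.
  by apply: eq_Rintegral => z _; rewrite /w; ring.
rewrite (funext QE) -null.
have [Lp Lp0 hLp] := conv_lip_unif (t + 1).
(* By linearity this is the potential of [u (v n) - u t], which is bounded by [D * |v n - t|] and
   supported in the ball of radius [r]. *)
have conv_dist n z : `|conv k (u (v n)) z - conv k (u t) z| <= D * `|v n - t| * ker_mass C z r.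
  have ms := lbs_measurable _ _ _ _ (hu _ (vT n)); have mt := lbs_measurable _ _ _ _ (hu t tT).
  have is' := integrable_ker_mul _ _ hC z _ M r r0 ms (lbs_bound (hu _ (vT n)))
    (lbs_supp (hu _ (vT n))).
  have it := integrable_ker_mul _ _ hC z _ M r r0 mt (lbs_bound (hu t tT)) (lbs_supp (hu t tT)).
  have -> : conv k (u (v n)) z - conv k (u t) z = conv k (fun y => u (v n) y - u t y) z.
    rewrite /conv -RintegralB//; apply: eq_Rintegral => y _; ring.
  apply: (conv_bound _ _ hC) => //; first exact: measurable_funB.
    by move=> y; exact: hD.
  by move=> y yr; rewrite (lbs_supp (hu _ (vT n)))// (lbs_supp (hu t tT))// subrr.
pose km := ker_mass C (((r, 0), 0) : phase R) r.
have conv_le s z : 0 <= s <= t + 1 -> `|z| <= r -> `|conv k (u s) z| <= M * km.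
  move=> sT zr.
  apply: (le_trans (conv_bound _ _ hC z (u s) M r r0 (lbs_measurable _ _ _ _ (hu s sT))
    (lbs_bound (hu s sT)) (lbs_supp (hu s sT)))).
  apply: ler_wpM2l => //; apply: ker_mass_mono hC _ _ _ r0 _.
  by rewrite (le_trans zr)// !prod_normE/= !le_max (ler_norm r).
(* [M * km] bounds the mean of the two potentials on the support, and [D] the difference quotient of
   [f] in time. *)
have [] := dominated_cvg4 w (fun z => conv k (u t) z * part_t f t z)
  (fun z => (M * km * D) * \1_(cball4 (0 : phase R) r) z).
- move=> n; apply: measurable_funM; apply: measurable_funM => //.
    by apply: measurable_funD; apply: continuous_measurable4;
      apply: lipschitz_continuous (hLp _ _).
  apply: measurable_funB.
    exact: lbs_measurable _ _ _ _ (hu _ (vT n)).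
  exact: lbs_measurable _ _ _ _ (hu _ tT).
- move=> z.
  have cphi : conv k (u (v n)) z @[n --> \oo] --> conv k (u t) z.
    apply/cvgrPdist_le => e e0.
    have q0 : 0 < D * ker_mass C z r + 1 by rewrite ltr_wpDl// mulr_ge0// (ker_mass_ge0 _ _ hC).
    have /cvgrPdist_lt/(_ _ (divr_gt0 e0 q0)) vt' := vt.
    near=> n; rewrite distrC.
    apply: (@le_trans _ _ ((D * ker_mass C z r + 1) * (e / (D * ker_mass C z r + 1)))).
      apply: (le_trans (conv_dist n z)).
      rewrite mulrAC; apply: ler_pM => //.
      + by rewrite mulr_ge0// (ker_mass_ge0 _ _ hC).
      + by rewrite lerDl.
      + by rewrite ltW// distrC; near: n.
    by rewrite mulrC divfK// gt_eqF.
  have -> : conv k (u t) z * part_t f t z = 2^-1 * (conv k (u t) z + conv k (u t) z)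
    * part_t f t z.
    by field.
  apply: cvgM; first by apply: cvgM; [exact: cvg_cst|apply: cvgD => //; exact: cvg_cst].
  apply/cvgrPdist_le => e e0.
  have /is_dRplusP/(_ _ e0)[d d0 hd] : is_dRplus (fun s => f s z.1 z.2) t (part_t f t z).
    exact: (@C1_dt _ _ fC1 t z.1 z.2 t0).
  have /cvgrPdist_lt/(_ _ d0) vd := vt.
  near=> n; have [v0 v1 _] := vP n.
  by rewrite distrC; apply: hd => //; rewrite distrC; near: n.
- exact: integrable_cst_cball.
- move=> n z; have [zr|zr] := leP `|z| r; last first.
    by rewrite /w !(lbs_supp (hu _ _) z zr)// subrr mul0r mulr0 normr0 indic_cball0// mulr0.
  rewrite indic_cball1// mulr1 /w normrM ler_pM//.
    rewrite normrM gtr0_norm ?invr_gt0// mulrC ler_pdivrMr// (le_trans (ler_normD _ _))//.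
    by rewrite mulr_natr mulr2n lerD// conv_le.
  by rewrite normrM normfV ler_pdivrMr ?normr_gt0//; exact: hD.
by [].
Unshelve. all: by end_near. Qed.
End Solution.

Theorem proposition3p2 (R : realType) (wc : R) (hwc : wc != 0)
    (fin : plane R -> plane R -> R)
    (fin_ge0 : forall x v, 0 <= fin x v)
    (fin_smooth : smooth (fun p => fin p.1 p.2))
    (fin_supp : compactly_supported (fun p => fin p.1 p.2))
    (f : R -> plane R -> plane R -> R) (hf : solution wc fin f)
    (t : R) (ht : 0 <= t) :
  is_dRplus (fun s => energy wc (f s)) t 0.
Proof. exact: energy_derivative hwc fin_supp hf t ht. Qed.
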